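(* Let $p$ be a prime number and let $G$ be a group of order $p^n$, $n\geq 2$, with an abelian subgroup $H$ of order $p^{n-1}$. Let $p^e$ be the exponent of $G$. Choose any $\alpha\in G$ such that $\alpha$ generates $G/H$, i.e. $\alpha\notin H$, $\alpha^p\in H$. Put $H^p=\{h^p : h\in H\}$ and $H(p)=\{h\in H : h^p=1,\ h\notin H^p\}$, and assume that $[h,\alpha]\in H(p)\cup\{1\}$ for every $h\in H(p)$. Assume that the $p$-th lower central subgroup $G_{(p)}$ is trivial, where $G_{(0)}=G$ and $G_{(i)}=[G,G_{(i-1)}]$ for $i\geq 1$. Let $K$ be a field such that either (i) $\operatorname{char} K=p>0$, or (ii) $\operatorname{char} K\neq p$ and $K$ contains a primitive $p^e$-th root of unity. Then $K(G)$ is rational over $K$.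
   Context: Commutators are $[a,b]=a^{-1}b^{-1}ab$, and $[G,G_{(i-1)}]$ denotes the subgroup generated by commutators of elements of $G$ and elements of $G_{(i-1)}$. For a field $K$ and a finite group $G$, let $K(x(g):g\in G)$ be the rational function field over $K$ in variables $x(g)$ indexed by $g\in G$, on which $G$ acts by $K$-automorphisms via $g\cdot x(h)=x(gh)$ for all $g,h\in G$. Then $K(G)$ denotes the fixed field $K(x(g):g\in G)^G$. A field extension $L$ of $K$ is called rational over $K$ if $L\simeq K(x_1,\ldots,x_m)$ over $K$ for some integer $m$, with $x_1,\ldots,x_m$ algebraically independent over $K$ (i.e. $L$ is purely transcendental over $K$ of finite transcendence degree). *)

(* Defs.v *)
From HB Require Import structures.
From mathcomp Require Import all_boot all_order all_algebra all_fingroup.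
From mathcomp Require Import all_solvable.
From mathcomp Require Import generic_quotient mpoly.

Set Implicit Arguments.
Unset Strict Implicit.
Unset Printing Implicit Defensive.

Import GRing.Theory.
Local Open Scope ring_scope.

Notation "x %:F" := (@FracField.tofrac _ x) : ring_scope.

Lemma frac_numden (R : idomainType) (x : {fraction R}) :
  x = (\n_(repr x))%:F / (\d_(repr x))%:F.
Proof.
have d0 : (\d_(repr x))%:F != 0 :> {fraction R}.
  by rewrite tofrac_eq0 denom_ratioP.
apply: (mulIf d0); rewrite divfK //; unlock FracField.tofrac.
rewrite -[X in X * _ = _]reprK -[LHS]FracField.pi_mul; apply/eqmodP.
rewrite /= FracField.equivfE /FracField.mulf.
have d1 := denom_ratioP (repr x).
by rewrite !numden_Ratio ?mulf_neq0 ?oner_neq0 // !mulr1 mulrC.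
Qed.

(* The extension of f : R -> S to fraction fields, n / d |-> f n / f d.  It   *)
(* is independent of the choice of n / d when f is an injective ring morphism *)
(* (frac_map_div).                                                            *)
Definition frac_map (R S : idomainType) (f : R -> S) (x : {fraction R}) :
  {fraction S} := (f \n_(repr x))%:F / (f \d_(repr x))%:F.

Section FracMap.
Variables (R S : idomainType) (f : {rmorphism R -> S}).
Hypothesis f_inj : injective f.

Lemma frac_map_div a b :
  b != 0 -> frac_map f (a%:F / b%:F) = (f a)%:F / (f b)%:F.
Proof.
move=> b0; rewrite /frac_map; set x := a%:F / b%:F.
have d0 := denom_ratioP (repr x).
have fb0 : (f b)%:F != 0 by rewrite tofrac_eq0 raddf_eq0.
have fd0 : (f \d_(repr x))%:F != 0 by rewrite tofrac_eq0 raddf_eq0.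
apply/eqP; rewrite eqr_div // -!tofracM tofrac_eq -!rmorphM (inj_eq f_inj).
rewrite -tofrac_eq !tofracM -eqr_div ?tofrac_eq0 //.
by rewrite -frac_numden.
Qed.

Lemma frac_map_tofrac a : frac_map f a%:F = (f a)%:F.
Proof.
by rewrite -[a%:F]divr1 -tofrac1 frac_map_div ?oner_neq0 // rmorph1 tofrac1 divr1.
Qed.

Lemma frac_map_zmod_morphism : zmod_morphism (frac_map f).
Proof.
move=> x y; rewrite [x in LHS]frac_numden [y in LHS]frac_numden [in RHS]/frac_map.
have x0 := denom_ratioP (repr x); have y0 := denom_ratioP (repr y).
have fF0 a : a != 0 -> (f a)%:F != 0 by rewrite tofrac_eq0 raddf_eq0.
rewrite -!mulNr !addf_div ?fF0 ?tofrac_eq0 //.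
rewrite -!tofracN -!tofracM -!tofracD frac_map_div ?mulf_neq0 //.
by rewrite !(rmorphM, rmorphD, rmorphN).
Qed.

Lemma frac_map_monoid_morphism : monoid_morphism (frac_map f).
Proof.
split=> [|x y]; first by rewrite -tofrac1 frac_map_tofrac rmorph1 tofrac1.
rewrite [x in LHS]frac_numden [y in LHS]frac_numden.
have x0 := denom_ratioP (repr x); have y0 := denom_ratioP (repr y).
rewrite mulf_div -!tofracM frac_map_div ?mulf_neq0 //.
by rewrite [in RHS]/frac_map mulf_div !(rmorphM, tofracM).
Qed.

End FracMap.

Section Subfield.
Variables (F : fieldType) (S : divringClosed F).

Definition subfield : Type := {x : F | x \in S}.

HB.instance Definition _ := SubChoice.on subfield.
HB.instance Definition _ := [SubChoice_isSubIntegralDomain of subfield by <:].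
HB.instance Definition _ := [SubIntegralDomain_isSubField of subfield by <:].

End Subfield.

Notation ratfun K n := {fraction {mpoly K[n]}}.

Definition ratfunC (K : fieldType) (n : nat) (c : K) : ratfun K n :=
  (c%:MP_[n])%:F.

HB.instance Definition _ (K : fieldType) n :=
  GRing.RMorphism.copy (@ratfunC K n) (@FracField.tofrac _ \o @mpolyC n K).

(* iota exhibits L as a field extension of K; phi is a K-isomorphism.         *)
(* The case m = 0, L = K, is included.                                        *)
Definition rational_over (K L : fieldType) (iota : {rmorphism K -> L}) : Prop :=
  exists (m : nat) (phi : {rmorphism ratfun K m -> L}),
    bijective phi /\ forall c : K, phi (ratfunC m c) = iota c.

Section Noether.
Variables (K : fieldType) (gT : finGroupType).

Definition noether_var (g : gT) : ratfun K #|gT| := ('X_(enum_rank g))%:F.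

Definition noether_subst (g : gT) (q : {mpoly K[#|gT|]}) : {mpoly K[#|gT|]} :=
  q \mPo [tuple 'X_(enum_rank (g * enum_val i)%g) | i < #|gT|].

HB.instance Definition _ g := GRing.RMorphism.copy (noether_subst g)
  (comp_mpoly [tuple 'X_(enum_rank (g * enum_val i)%g) | i < #|gT|]).

(* The K-automorphism of K(x(h) : h in gT) with g . x(h) = x(gh), as checked  *)
(* by noether_act_var and noether_act_C.                                      *)
Definition noether_act (g : gT) : ratfun K #|gT| -> ratfun K #|gT| :=
  frac_map (noether_subst g).

Lemma noether_subst_var g h :
  noether_subst g 'X_(enum_rank h) = 'X_(enum_rank (g * h)%g).
Proof. by rewrite /noether_subst comp_mpolyXU -tnth_nth tnth_mktuple enum_rankK. Qed.

Lemma noether_substK g : cancel (noether_subst g) (noether_subst g^-1).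
Proof.
move=> q; rewrite [RHS](mpolyE q) [in LHS](mpolyE q).
rewrite (rmorph_sum (noether_subst g)) (rmorph_sum (noether_subst g^-1)).
apply: eq_bigr => m _.
rewrite -mul_mpolyC !rmorphM /= /noether_subst !comp_mpolyC; congr (_ * _).
rewrite comp_mpolyX rmorph_prod /= [RHS]mpolyXE_id; apply: eq_bigr => i _.
rewrite rmorphXn /= tnth_mktuple -/(noether_subst _ _) noether_subst_var.
by rewrite mulKg enum_valK.
Qed.

Lemma noether_subst_inj g : injective (noether_subst g).
Proof. exact: can_inj (noether_substK g). Qed.

HB.instance Definition _ g := GRing.isZmodMorphism.Build _ _ (noether_act g)
  (frac_map_zmod_morphism (@noether_subst_inj g)).
HB.instance Definition _ g := GRing.isMonoidMorphism.Build _ _ (noether_act g)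
  (frac_map_monoid_morphism (@noether_subst_inj g)).

Lemma noether_act_var g h :
  noether_act g (noether_var h) = noether_var (g * h)%g.
Proof.
rewrite /noether_act frac_map_tofrac; last exact: noether_subst_inj.
by rewrite /= noether_subst_var.
Qed.

Lemma noether_act_C g c : noether_act g (ratfunC _ c) = ratfunC _ c.
Proof.
rewrite /noether_act frac_map_tofrac; last exact: noether_subst_inj.
by rewrite /= /noether_subst comp_mpolyC.
Qed.

Definition noether_fixed : {pred ratfun K #|gT|} :=
  fun f => [forall g : gT, noether_act g f == f].

Lemma noether_fixedP f :
  reflect (forall g, noether_act g f = f) (f \in noether_fixed).
Proof. exact: 'forall_eqP. Qed.

Lemma noether_fixed_divring_closed : divring_closed noether_fixed.
Proof.
split=> [|x y /noether_fixedP fx /noether_fixedP fy|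
          x y /noether_fixedP fx /noether_fixedP fy]; apply/noether_fixedP => g.
- exact: rmorph1.
- by rewrite rmorphB /= fx fy.
- by rewrite fmorph_div /= fx fy.
Qed.

HB.instance Definition _ :=
  GRing.isDivringClosed.Build _ noether_fixed noether_fixed_divring_closed.

Definition noether_field : fieldType := subfield noether_fixed.

Lemma ratfunC_fixed c : ratfunC #|gT| c \in noether_fixed.
Proof. by apply/noether_fixedP => g; rewrite noether_act_C. Qed.

Definition noether_fieldC (c : K) : noether_field :=
  exist _ (ratfunC #|gT| c) (ratfunC_fixed c).

Lemma noether_fieldC_zmod_morphism : zmod_morphism noether_fieldC.
Proof. by move=> c d; apply: val_inj; rewrite /= rmorphB. Qed.

Lemma noether_fieldC_monoid_morphism : monoid_morphism noether_fieldC.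
Proof. by split=> [|c d]; apply: val_inj; rewrite /= (rmorph1, rmorphM). Qed.

HB.instance Definition _ := GRing.isZmodMorphism.Build _ _ noether_fieldC
  noether_fieldC_zmod_morphism.
HB.instance Definition _ := GRing.isMonoidMorphism.Build _ _ noether_fieldC
  noether_fieldC_monoid_morphism.

End Noether.

Section PowerSets.
Variables (gT : finGroupType) (p : nat) (H : {set gT}).
Local Open Scope group_scope.

Definition pth_powers : {set gT} := [set h ^+ p | h in H].

Definition nonpower_torsion : {set gT} :=
  [set h in H | (h ^+ p == 1) && (h \notin pth_powers)].

End PowerSets.

(* The series G_(0) = G, G_(i) = [G, G_(i-1)] has G_(i) = 'L_i.+1(G), since   *)
(* the library starts at 'L_1(G) = G; in particular G_(p) = 'L_p.+1(G).       *)
Lemma lcn_iter (gT : finGroupType) (G : {group gT}) i :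
  'L_i.+1(G)%g = iter i (fun A : {set gT} => [~: G, A]%g) G.
Proof. by elim: i => [|i IHi] //=; rewrite -IHi commGC. Qed.

(* Main.v *)
(* In characteristic p the left regular representation has a G-stable flag,   *)
(* so K(x(g) : g in G) is a tower of one-variable extensions on which G acts  *)
(* by affine substitutions; the invariants of such a tower form a purely      *)
(* transcendental tower over the invariants of its base.                      *)
(*                                                                            *)
(* Otherwise diagonalise H on the span of x(h), h in H, with eigenvectors     *)
(* u_i, and put x_ij = alpha^j u_i.  After rescaling by p-th roots in K, the  *)
(* ratios y_ij = x_i,j+1 / x_ij satisfy alpha y_ij = y_i,j+1 and              *)
(* prod_(j < p) y_ij = 1, i.e. for each i they span a lattice isomorphic to   *)
(* Z[zeta_p] on which alpha acts as zeta_p, while H acts by characters.       *)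
(* Climbing through normal subgroups D of G contained in H, one central step  *)
(* of index p at a time, replaces this lattice by a submodule of index p,     *)
(* which is again free because the prime above p is principal; so K(y)^H is   *)
(* generated by a family w of the same shape.  The action of alpha on K(w)    *)
(* linearises through T_j = U_j / (U_0 + ... + U_(p-1)), with                 *)
(* U_j = w_0 ... w_(j-1), and is then diagonalised by a Fourier transform.    *)
(* Finally the u_i are adjoined to K(y), on which G acts affinely.            *)
(* Algebraic independence is always deduced from Steinitz' theorem by         *)
(* counting generators.                                                       *)
From HB Require Import structures.
Require Import Defs.
From mathcomp Require Import all_boot all_order all_algebra all_fingroup.
From mathcomp Require Import all_solvable all_character.
From mathcomp Require Import generic_quotient mpoly boolp.

Set Implicit Arguments.
Unset Strict Implicit.
Unset Printing Implicit Defensive.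

Import GRing.Theory.
Local Open Scope ring_scope.

(** * Subfields generated by a sequence *)

(** Write F for K(x(g) : g in G) and k for the constants. Everything rests on one descent principle,
    [affine_tower_invariants]: if F is built over a G-stable subfield L by successive transcendental
    elements, each sent by every g to a x + b with a, b in the field below, then the invariants of F
    are purely transcendental over those of L. The one-variable case is [affine_invariants].

    In characteristic p, a p-group acting on a nonzero quotient of the regular representation fixes
    a nonzero vector, so the linear forms have a G-stable flag with trivial action on its quotients.
    A basis adapted to the flag is an affine tower over k ([pgroup_affine_tower]), and descent
    finishes.

    Otherwise, H is abelian and K has enough roots of unity, so the span of the x(h), h in H, has a
    basis of eigenvectors u_i of H ([abelian_eigenbasis]). G permutes the lines of their translates
    by powers of alpha. Over the field k(Y) of normalised ratios of consecutive translates, each u_i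
    is only scaled by G, so by descent it suffices to treat k(Y). There H acts by characters and is
    removed first: [family_step] divides out one central step of index p while preserving the shape
    of the generators, and [family_invariants] iterates this up to H. On the resulting field k(w)
    only alpha acts nontrivially, cyclically with product 1 in each row. The substitution of section
    [Linearize] turns this into a permutation of coordinates with sum 1, which a discrete Fourier
    transform diagonalises ([fourier_field]). A second use of descent gives k(Y)^G
    ([fourier_invariants]), and [monomial_invariants] assembles the two layers.

    Independence is never checked by hand: a family that generates F up to algebraic elements and
    has no more members than a known independent family is itself independent ([tower_of_size]). *)

Section Generation.
Variable F : fieldType.
Implicit Types (L M : divringClosed F) (x y z : F) (xs ys : seq F).

(** Taken as the intersection of all subfields containing [L] and [xs], so that minimality is the
    definition itself and no explicit fractions are needed; those appear only for one generator, in
    [adjoin1P]. *)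
Definition adjoin L xs : {pred F} := fun z =>
  `[< forall M, {subset L <= M} -> {subset xs <= M} -> z \in M >].

Lemma adjoinP L xs z :
  reflect (forall M, {subset L <= M} -> {subset xs <= M} -> z \in M)
          (z \in adjoin L xs).
Proof. exact: asboolP. Qed.

Lemma adjoin_divring_closed L xs : divring_closed (adjoin L xs).
Proof.
split=> [|x y /adjoinP hx /adjoinP hy|x y /adjoinP hx /adjoinP hy]; apply/adjoinP => M LM xM.
- exact: rpred1.
- by rewrite rpredB ?hx ?hy.
- by rewrite rpred_div ?hx ?hy.
Qed.

HB.instance Definition _ L xs :=
  GRing.isDivringClosed.Build F (adjoin L xs) (adjoin_divring_closed L xs).

Lemma sub_adjoin L xs : {subset L <= adjoin L xs}.
Proof. by move=> x Lx; apply/adjoinP => M LM _; apply: LM. Qed.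

Lemma mem_adjoin L xs : {subset xs <= adjoin L xs}.
Proof. by move=> x Lx; apply/adjoinP => M _; apply. Qed.

Lemma adjoin_min L xs M :
  {subset L <= M} -> {subset xs <= M} -> {subset adjoin L xs <= M}.
Proof. by move=> LM xM z /adjoinP; apply. Qed.

Lemma adjoin_sub L M xs ys :
  {subset L <= M} -> {subset xs <= ys} -> {subset adjoin L xs <= adjoin M ys}.
Proof.
by move=> LM xy; apply: adjoin_min => x xin; [apply/sub_adjoin/LM | apply/mem_adjoin/xy].
Qed.

Lemma adjoin_nil L : adjoin L [::] =i L.
Proof. by move=> x; apply/idP/idP; [apply: adjoin_min | apply: sub_adjoin]. Qed.

Lemma adjoin_cat L xs ys : adjoin L (xs ++ ys) =i adjoin (adjoin L xs) ys.
Proof.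
move=> z; apply/idP/idP; apply: adjoin_min => x.
- by move=> Lx; do 2!apply: sub_adjoin.
- by rewrite mem_cat => /orP[] xin; [apply/sub_adjoin/mem_adjoin | apply: mem_adjoin].
- by apply: adjoin_sub => // {}x xin; rewrite mem_cat xin.
- by move=> xin; apply: mem_adjoin; rewrite mem_cat xin orbT.
Qed.

Lemma adjoin_cons L x xs : adjoin L (x :: xs) =i adjoin (adjoin L [:: x]) xs.
Proof. exact: (adjoin_cat L [:: x]). Qed.

Lemma eq_adjoin L M xs ys : L =i M -> xs =i ys -> adjoin L xs =i adjoin M ys.
Proof.
by move=> LM xy z; apply/idP/idP; apply: adjoin_sub => x; rewrite ?LM ?xy.
Qed.

Lemma polyOver_sub L M : {subset L <= M} ->
  {subset polyOver L <= polyOver M}.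
Proof. by move=> LM p /polyOverP pL; apply/polyOverP => i; apply: LM. Qed.

Lemma horner_mem L M p x : {subset L <= M} -> p \is a polyOver L -> x \in M ->
  p.[x] \in M.
Proof. by move=> LM pL xM; apply: rpred_horner => //; apply: polyOver_sub pL. Qed.

Definition adjoin1_pred L x : {pred F} := fun z =>
  `[< exists p q, [/\ p \is a polyOver L, q \is a polyOver L, q.[x] != 0
                    & z = p.[x] / q.[x]] >].

Lemma adjoin1_divring_closed L x : divring_closed (adjoin1_pred L x).
Proof.
split=> [|y z /asboolP[p][q][pL qL q0 ->] /asboolP[p'][q'][p'L q'L q'0 ->]
         |y z /asboolP[p][q][pL qL q0 ->] /asboolP[p'][q'][p'L q'L q'0 ->]];
  apply/asboolP.
- by exists 1, 1; rewrite rpred1 hornerE oner_neq0 mulfV ?oner_neq0.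
- exists (p * q' - p' * q), (q * q').
  rewrite !(rpredB, rpredM) // !hornerE mulf_neq0 //; split=> //.
  by rewrite -mulNr addf_div // mulNr.
- have [p'0|p'0] := eqVneq p'.[x] 0.
    exists 0, 1; rewrite rpred0 rpred1 !hornerE oner_neq0; split=> //.
    by rewrite p'0 mul0r invr0 mulr0 ?mul0r.
  exists (p * q'), (q * p').
  by rewrite !rpredM // !hornerE mulf_neq0 // invf_div mulf_div.
Qed.

HB.instance Definition _ L x :=
  GRing.isDivringClosed.Build F (adjoin1_pred L x) (adjoin1_divring_closed L x).

Lemma adjoin1P L x z :
  reflect (exists p q, [/\ p \is a polyOver L, q \is a polyOver L, q.[x] != 0
                         & z = p.[x] / q.[x]])
          (z \in adjoin L [:: x]).
Proof.
have xg : x \in adjoin L [:: x] by apply: mem_adjoin; rewrite inE.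
apply: (iffP idP) => [|[p][q][pL qL q0 ->]]; last first.
  by rewrite rpred_div ?(horner_mem (@sub_adjoin L [:: x])).
move=> zg; have/asboolP// : z \in adjoin1_pred L x.
apply: adjoin_min zg => {}z.
  move=> Lz; apply/asboolP; exists z%:P, 1.
  by rewrite polyOverC rpred1 !hornerE oner_neq0 ?invr1 ?mulr1.
rewrite inE => /eqP->; apply/asboolP; exists 'X, 1.
by rewrite polyOverX rpred1 !hornerE oner_neq0 ?invr1 ?mulr1.
Qed.

Definition algcl L : {pred F} := fun x =>
  `[< exists p, [/\ p \is a polyOver L, p != 0 & root p x] >].

Lemma algclP L x :
  reflect (exists p, [/\ p \is a polyOver L, p != 0 & root p x])
          (x \in algcl L).
Proof. exact: asboolP. Qed.

Local Notation inj L := (val : subfield L -> F).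

Lemma polyOver_subfield L p : p \is a polyOver L ->
  exists q : {poly subfield L}, p = map_poly (inj L) q.
Proof.
move=> /polyOverP pL; exists (\poly_(i < size p) (exist _ p`_i (pL i) : subfield L)).
apply/polyP => i; rewrite coef_map coef_poly.
by case: ltnP => [_ //|ip] /=; rewrite nth_default.
Qed.

(** Bridge to algebraicity along the inclusion of [subfield L], from which closure under field
    operations and transitivity ([algcl_id]) are imported. *)
Lemma algcl_algebraicOver L x : x \in algcl L <-> algebraicOver (inj L) x.
Proof.
split=> [/algclP[p [pL p0 px]]|[p p0 px]].
  have [q def_p] := polyOver_subfield pL; exists q; last by rewrite -def_p.
  by apply: contraNneq p0 => q0; rewrite def_p q0 map_poly0.
apply/algclP; exists (map_poly (inj L) p); rewrite map_poly_eq0 p0 px.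
by split=> //; apply/polyOverP => i; rewrite coef_map /=; apply: valP.
Qed.

Lemma algcl_divring_closed L : divring_closed (algcl L).
Proof.
split=> [|x y /algcl_algebraicOver hx /algcl_algebraicOver hy
         |x y /algcl_algebraicOver hx /algcl_algebraicOver hy];
  apply/algcl_algebraicOver.
- exact: algebraic1.
- exact: algebraic_sub.
- exact: algebraic_div.
Qed.

HB.instance Definition _ L :=
  GRing.isDivringClosed.Build F (algcl L) (algcl_divring_closed L).

Lemma sub_algcl L : {subset L <= algcl L}.
Proof.
move=> x Lx; apply/algclP; exists ('X - x%:P).
by rewrite polyOverXsubC polyXsubC_eq0 root_XsubC.
Qed.

Lemma algcl_sub L M : {subset L <= M} -> {subset algcl L <= algcl M}.
Proof.
move=> LM x /algclP[p [pL p0 px]]; apply/algclP; exists p; split=> //.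
exact: polyOver_sub pL.
Qed.

Lemma algcl_id L : {subset algcl (algcl L) <= algcl L}.
Proof.
move=> x /algclP[p [pL p0 px]]; apply/algcl_algebraicOver/integral_algebraic.
apply: (integral_root p0 px) => c /(nthP 0)[i _ <-].
by apply/integral_algebraic/algcl_algebraicOver/(polyOverP pL).
Qed.

Lemma algcl_adjoin L M xs : {subset L <= algcl M} -> {subset xs <= algcl M} ->
  {subset algcl (adjoin L xs) <= algcl M}.
Proof.
move=> LM xM z zg; apply: algcl_id; apply: algcl_sub zg; exact: adjoin_min.
Qed.

End Generation.

(** * Algebraic dependence *)

Section Transcendence.
Variable F : fieldType.
Implicit Types (L M : divringClosed F) (x y z : F) (xs ys : seq F).

Lemma common_denominator (R : F -> Prop) n (z : nat -> F) :
  R 1 -> (forall a b, R a -> R b -> R (a * b)) ->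
  (forall i, (i < n)%N -> exists a b, [/\ R a, R b, b != 0 & z i = a / b]) ->
  exists b, [/\ R b, b != 0 & forall i, (i < n)%N -> R (b * z i)].
Proof.
move=> R1 RM; elim: n => [|n IHn] zR.
  by exists 1; rewrite oner_neq0; split.
have [i ltin|b [Rb b0 bz]] := IHn; first by apply: zR; rewrite ltnS ltnW.
have [a [d [Ra Rd d0 def_z]]] := zR n (leqnn _).
exists (b * d); rewrite mulf_neq0 //; split=> [|//|i]; first exact: RM.
rewrite ltnS leq_eqVlt => /orP[/eqP->|ltin].
  by rewrite def_z -mulrA [d * _]mulrC divfK //; apply: RM.
by rewrite -mulrA [d * _]mulrC mulrA; apply: RM => //; apply: bz.
Qed.

(** The exchange property: clear denominators in an equation for x over L(y) to get a two-variable
    relation over L, then read it as an equation for y over L(x). *)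
Lemma algcl_exchange L x y : x \in algcl (adjoin L [:: y]) -> x \notin algcl L ->
  y \in algcl (adjoin L [:: x]).
Proof.
move=> /algclP[p [pL p0 px]] xL.
pose R z := exists2 q, q \is a polyOver L & z = q.[y].
have [||i _|b [Rb b0 bp]] := @common_denominator R (size p) (fun i => p`_i).
- by exists 1; rewrite ?rpred1 ?hornerE.
- by move=> _ _ [q qL ->] [r rL ->]; exists (q * r); rewrite ?rpredM ?hornerM.
- have /adjoin1P[q [r [qL rL r0 ->]]] := polyOverP pL i.
  by exists q.[y], r.[y]; split=> //; [exists q | exists r].
have {}bp (i : 'I_(size p)) : {q | q \is a polyOver L & b * p`_i = q.[y]}.
  by apply: cid2; apply: bp.
pose c i := s2val (bp i).
have cL i : c i \is a polyOver L by rewrite /c; case: (bp i).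
have cE i : (c i).[y] = b * p`_i by rewrite /c; case: (bp i).
apply/algclP; exists (\sum_(i < size p) x ^+ i *: c i); split.
- apply: rpred_sum => i _; rewrite polyOverZ //.
    by rewrite rpredX // mem_adjoin ?inE.
  by apply: polyOver_sub (cL i); apply: sub_adjoin.
(* If the relation vanished as a polynomial in y, each of its coefficients would be an equation for
   x over L. The one at the degree j of a nonzero [c i] is a nontrivial equation, so x would be
   algebraic over L. *)
- apply: contraNneq xL => sum0; apply/algclP.
  have [i ci0] : exists i : 'I_(size p), c i != 0.
    case: (size p =P 0%N) => [|/eqP]; first by move/eqP; rewrite size_poly_eq0 (negPf p0).
    rewrite -lt0n => sp; have ltp : ((size p).-1 < size p)%N by rewrite ltn_predL.
    exists (Ordinal ltp); apply: contraNneq p0 => /(congr1 (horner^~ y)).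
    rewrite cE horner0 /= => /eqP; rewrite mulf_eq0 (negPf b0) /=.
    by rewrite -lead_coefE lead_coef_eq0.
  pose j := (size (c i)).-1.
  exists (\poly_(k < size p) (if insub k is Some i then (c i)`_j else 0)); split.
  + apply/polyOverP => k; rewrite coef_poly; case: ifP; last by rewrite rpred0.
    by case: insubP => [u _ _|_] _; rewrite ?rpred0 ?(polyOverP (cL u)).
  + apply: contraNneq ci0 => /(congr1 (fun q : {poly F} => q`_i)).
    rewrite coef0 coef_poly ltn_ord valK => /eqP.
    by rewrite -lead_coefE lead_coef_eq0.
  + apply/eqP; rewrite horner_poly; move/(congr1 (fun q : {poly F} => q`_j)): sum0.
    rewrite coef0 coef_sum => sum0; rewrite -[RHS]sum0; apply: eq_bigr => k _.
    by rewrite valK coefZ mulrC.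
- apply/eqP; rewrite horner_sum; transitivity (b * p.[x]); last first.
    by rewrite (rootP px) mulr0.
  rewrite (horner_coef p) mulr_sumr; apply: eq_bigr => i _.
  by rewrite hornerZ cE mulrC mulrA.
Qed.

(** Algebraic independence of [xs] over [L], stated one element at a time so that it concatenates
    ([tower_cat]) and fits inductions on the list. *)
Fixpoint tower L xs : Prop :=
  if xs is x :: xs' then x \notin algcl L /\ tower (adjoin L [:: x]) xs' else True.

Lemma tower_sub L M xs : {subset L <= M} -> tower M xs -> tower L xs.
Proof.
elim: xs L M => //= x xs IHxs L M LM [xM txs]; split.
  by apply: contra xM; apply: algcl_sub.
by apply: IHxs txs; apply: adjoin_sub.
Qed.

Lemma tower_cat L xs ys :
  tower L (xs ++ ys) <-> tower L xs /\ tower (adjoin L xs) ys.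
Proof.
elim: xs L => [|x xs IHxs] L /=.
  by split=> [t|[_ t]]; [split=> // | ]; apply: (tower_sub _ t) => z; rewrite adjoin_nil.
split=> [[xL /IHxs[txs tys]]|[[xL txs] tys]].
  by do 2?split=> //; apply: (tower_sub _ tys) => z; rewrite -adjoin_cons.
by split=> //; apply/IHxs; split=> //; apply: (tower_sub _ tys) => z; rewrite -adjoin_cons.
Qed.

(** Induction on [xs]: the head x is exchanged for some y of [ys], and x is moved into the base
    field. *)
Lemma steinitz L xs ys :
  tower L xs -> {subset xs <= algcl (adjoin L ys)} -> (size xs <= size ys)%N.
Proof.
elim: xs L ys => //= x xs IHxs L ys [xL txs] xsy.
(* y is the first element of [ys] whose adjunction makes x algebraic, so exchange applies over
   L([ys1]). *)
have [ys1 [y [ys2 [def_ys x1 x2]]]] : exists ys1 y ys2,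
    [/\ ys = ys1 ++ y :: ys2, x \notin algcl (adjoin L ys1)
      & x \in algcl (adjoin L (rcons ys1 y))].
  have: x \in algcl (adjoin L ys) by apply: xsy; rewrite inE eqxx.
  elim/last_ind: ys {xsy} => [|ys y IHys].
    by move=> /(algcl_sub (fun z => etrans (esym (adjoin_nil L z)))) xL'; case/negP: xL.
  have [/IHys[ys1 [z [ys2 [-> x1 x2]]]] _|x1 x2] := boolP (x \in algcl (adjoin L ys)).
    by exists ys1, z, (rcons ys2 y); rewrite rcons_cat.
  by exists ys, y, [::]; rewrite cats1.
have yx : y \in algcl (adjoin (adjoin L ys1) [:: x]).
  apply: algcl_exchange x1; apply: algcl_sub x2 => z.
  by rewrite -cats1 adjoin_cat.
rewrite def_ys size_cat /= addnS -size_cat ltnS; apply: IHxs txs _ => z zxs.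
have Lsub : {subset L <= algcl (adjoin (adjoin L [:: x]) (ys1 ++ ys2))}.
  by move=> u Lu; apply/sub_algcl/sub_adjoin/sub_adjoin.
apply: algcl_adjoin (xsy z _) => //; last by rewrite inE zxs orbT.
move=> u; rewrite def_ys mem_cat inE => /or3P[u1|/eqP->|u2].
- by apply/sub_algcl/mem_adjoin; rewrite mem_cat u1.
- apply: algcl_sub yx => {}u; rewrite -adjoin_cat => ug.
  rewrite -adjoin_cons; apply: adjoin_sub ug => // {}u.
  by rewrite mem_cat !inE mem_cat => /orP[] ->; rewrite ?orbT.
- by apply/sub_algcl/mem_adjoin; rewrite mem_cat u2 orbT.
Qed.

Lemma not_tower L ys : ~ tower L ys ->
  exists ys1 y ys2, ys = ys1 ++ y :: ys2 /\ y \in algcl (adjoin L ys1).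
Proof.
elim: ys L => [|y ys IHys] L /=; first by case.
have [yL _|yL ty] := boolP (y \in algcl L).
  by exists [::], y, ys; split=> //; apply: algcl_sub yL; apply: sub_adjoin.
have [|ys1 [z [ys2 [-> zL]]]] := IHys (adjoin L [:: y]); first by move=> t; apply: ty.
exists (y :: ys1), z, ys2; split=> //.
by apply: algcl_sub zL => u; rewrite -adjoin_cons.
Qed.

(** An element of [ys] algebraic over its predecessors could be dropped, leaving fewer elements than
    Steinitz allows. *)
Lemma tower_of_size L xs ys : tower L xs -> {subset xs <= algcl (adjoin L ys)} ->
  (size ys <= size xs)%N -> tower L ys.
Proof.
move=> txs xsy szy; apply: contrapT => /not_tower[ys1 [y [ys2 [def_ys yL]]]].
have: (size xs <= size (ys1 ++ ys2))%N.
  apply: (steinitz txs) => x /xsy; apply: algcl_adjoin => {x}.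
    by move=> u Lu; apply/sub_algcl/sub_adjoin.
  move=> u; rewrite def_ys mem_cat inE => /or3P[u1|/eqP->|u2].
  - by apply/sub_algcl/mem_adjoin; rewrite mem_cat u1.
  - by apply: algcl_sub yL; apply: adjoin_sub => // {}u u1; rewrite mem_cat u1.
  - by apply/sub_algcl/mem_adjoin; rewrite mem_cat u2 orbT.
by apply/negP; rewrite -ltnNge (leq_trans _ szy) // def_ys !size_cat addnS.
Qed.

End Transcendence.

(** * Affine actions on towers *)

Section Action.
Variables (F : fieldType) (gT : finGroupType) (act : gT -> {rmorphism F -> F}).
Hypothesis act1 : forall x, act 1%g x = x.
Hypothesis actM : forall g h x, act (g * h)%g x = act g (act h x).
Implicit Types (L M : divringClosed F) (x y z : F) (xs ys : seq F).

Definition invariants L : {pred F} := [pred x | (x \in L) && [forall g, act g x == x]].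

Lemma invariantsP L x :
  reflect (x \in L /\ forall g, act g x = x) (x \in invariants L).
Proof. by rewrite inE; apply: (iffP andP) => -[-> /'forall_eqP]. Qed.

Lemma invariants_divring_closed L : divring_closed (invariants L).
Proof.
split=> [|x y /invariantsP[xL fx] /invariantsP[yL fy]
         |x y /invariantsP[xL fx] /invariantsP[yL fy]];
  apply/invariantsP; split=> [|g].
- exact: rpred1.
- exact: rmorph1.
- exact: rpredB.
- by rewrite rmorphB fx fy.
- exact: rpred_div.
- by rewrite fmorph_div fx fy.
Qed.

HB.instance Definition _ L :=
  GRing.isDivringClosed.Build F (invariants L) (invariants_divring_closed L).

Definition act_stable L := forall g x, x \in L -> act g x \in L.

Lemma actK g : cancel (act g) (act g^-1%g).
Proof. by move=> x; rewrite -actM mulVg act1. Qed.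

Lemma act_adjoin g L M xs : (forall x, x \in L -> act g x \in M) ->
  (forall x, x \in xs -> act g x \in M) ->
  forall x, x \in adjoin L xs -> act g x \in M.
Proof.
(* The preimage of a subfield under [act g] is a subfield, so minimality of [adjoin] applies to
   it. *)
move=> LM xsM x xin; pose P : {pred F} := fun z => act g z \in M.
have Pdr : divring_closed P.
  split=> [|u v uP vP|u v uP vP]; rewrite unfold_in.
  - by rewrite rmorph1 rpred1.
  - by rewrite rmorphB rpredB.
  - by rewrite fmorph_div rpred_div.
pose Pi := GRing.isDivringClosed.Build F P Pdr.
pose P' : divringClosed F := HB.pack P Pi.
suff: x \in P' by [].
by apply: adjoin_min xin => z; [apply: LM | apply: xsM].
Qed.

Lemma act_stable_adjoin L xs : act_stable L ->
  (forall g x, x \in xs -> act g x \in adjoin L xs) -> act_stable (adjoin L xs).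
Proof.
by move=> Ls xss g; apply: act_adjoin => x xin; [apply/sub_adjoin/Ls | apply: xss].
Qed.

Lemma transcendental_eq0 L x p : x \notin algcl L -> p \is a polyOver L ->
  p.[x] = 0 -> p = 0.
Proof.
move=> xL pL px; apply: contraNeq xL => p0; apply/algclP; exists p.
by split=> //; apply/rootP.
Qed.

Definition poly_values L x z := exists2 p, p \is a polyOver L & z = p.[x].

Lemma poly_values_prod L x (I : finType) (P : pred I) (z : I -> F) :
  (forall i, P i -> poly_values L x (z i)) -> poly_values L x (\prod_(i | P i) z i).
Proof.
move=> zR; elim/big_ind: _ => // [|_ _ [p pL ->] [q qL ->]].
  by exists 1; rewrite ?rpred1 ?hornerE.
by exists (p * q); rewrite ?rpredM ?hornerM.
Qed.

(** Replace the denominator by its norm over [D]. The norm is invariant, hence so is the new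
    numerator, being the product of the norm with the invariant z; both remain polynomials in x. *)
Lemma invariant_fraction (D : {group gT}) L x z :
  (forall g p, g \in D -> p \is a polyOver L -> poly_values L x (act g p.[x])) ->
  z \in adjoin L [:: x] -> (forall g, g \in D -> act g z = z) ->
  exists p q, [/\ p \is a polyOver L, q \is a polyOver L, q.[x] != 0,
    z = p.[x] / q.[x]
    & forall g, g \in D -> act g p.[x] = p.[x] /\ act g q.[x] = q.[x]].
Proof.
move=> DL /adjoin1P[p [q [pL qL q0 def_z]]] fz.
pose N := \prod_(g in D) act g q.[x].
have N0 : N != 0.
  by apply/prodf_neq0 => g _; rewrite fmorph_eq0.
have fN g : g \in D -> act g N = N.
  move=> gD; rewrite rmorph_prod [RHS](reindex_inj (mulgI g)) /=.
  by apply: eq_big => [h|h _]; rewrite ?groupMl // actM.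
have [q' q'L Nq'] : poly_values L x N by apply: poly_values_prod => g gD; apply: DL.
have [r rL Nr] : poly_values L x (\prod_(g in D | g != 1%g) act g q.[x]).
  by apply: poly_values_prod => g /andP[gD _]; apply: DL.
have zN : z * N = (p * r).[x].
  by rewrite hornerM -Nr /N (bigD1 1%g) //= act1 def_z mulrA divfK.
exists (p * r), q'; rewrite -zN -Nq' rpredM // mulfK //; split=> // g gD.
by rewrite rmorphM fz // fN.
Qed.

Lemma polyOver_divp_modp L p q : p \is a polyOver L -> q \is a polyOver L ->
  p %/ q \is a polyOver L /\ p %% q \is a polyOver L.
Proof.
move=> /polyOver_subfield[p' ->] /polyOver_subfield[q' ->].
rewrite -map_divp -map_modp.
by split; apply/polyOverP => i; rewrite coef_map /=; apply: valP.
Qed.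

Section AffineVariable.
Variables (L : divringClosed F) (x : F).
Hypothesis L_stable : act_stable L.
Hypothesis xL : x \notin algcl L.
Hypothesis x_affine : forall g, exists a b, [/\ a \in L, b \in L & act g x = a * x + b].

(** The degree bound is what lets invariance pass to the quotient and remainder in
    [affine_invariants]. *)
Lemma act_poly g p : p \is a polyOver L ->
  exists q, [/\ q \is a polyOver L, (size q <= size p)%N & act g p.[x] = q.[x]].
Proof.
move=> pL; have [a [b [aL bL gx]]] := x_affine g.
have lin : a *: 'X + b%:P \is a polyOver L.
  by rewrite rpredD ?polyOverC ?polyOverZ ?polyOverX.
exists (map_poly (act g) p \Po (a *: 'X + b%:P)); split.
- apply: polyOver_comp => //; apply/polyOverP => i.
  by rewrite coef_map /= L_stable ?(polyOverP pL).
- have [->|p0] := eqVneq p 0; first by rewrite map_poly0 comp_poly0 size_poly0.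
  apply: leq_trans (size_comp_poly_leq _ _) _; rewrite size_map_poly.
  have: (size (a *: 'X + b%:P)%R <= 2)%N.
    rewrite (leq_trans (size_polyD _ _)) // geq_max.
    rewrite (leq_trans (size_scale_leq _ _)) ?size_polyX //.
    by rewrite ?(leq_trans (size_polyC_leq1 _)).
  move=> le2; apply: (@leq_trans ((size p).-1 * 1).+1); last first.
    by rewrite muln1 prednK ?size_poly_gt0.
  by rewrite ltnS leq_mul //; case: (size _) le2.
- by rewrite horner_comp !hornerE -gx horner_map.
Qed.

Lemma affine_slope_neq0 g a b : a \in L -> b \in L -> act g x = a * x + b -> a != 0.
Proof.
move=> aL bL gx; apply: contraNneq xL => a0; apply: sub_algcl.
by rewrite -[x](actK g) gx a0 mul0r add0r; apply: L_stable.
Qed.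

Let inv p := p \is a polyOver L /\ forall g, act g p.[x] = p.[x].

(** The orbit product of x is a product of polynomials of degree exactly 1 in x, since slopes are
    nonzero. *)
Lemma exists_invariant : exists p, inv p /\ (1 < size p)%N.
Proof.
have [a a_x] := choice x_affine.
have [b ab_x] := choice a_x.
exists (\prod_g (a g *: 'X + (b g)%:P)); split; [split=> [|g]|].
- apply: rpred_prod => g _; have [aL bL _] := ab_x g.
  by rewrite rpredD ?polyOverC ?polyOverZ ?polyOverX.
- have -> : (\prod_g (a g *: 'X + (b g)%:P)).[x] = \prod_g act g x.
    by rewrite horner_prod; apply: eq_bigr => h _; have [_ _ ->] := ab_x h;
      rewrite !hornerE.
  rewrite rmorph_prod [RHS](reindex_inj (mulgI g)) /=.
  by apply: eq_bigr => h _; rewrite actM.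
have a0 g : a g != 0 by have [aL bL gx] := ab_x g; apply: affine_slope_neq0 gx.
have size2 g : size (a g *: 'X + (b g)%:P) = 2.
  by rewrite size_polyDl size_scale ?size_polyX // (leq_ltn_trans (size_polyC_leq1 _)).
rewrite (bigD1 1%g) //= size_mul; last 2 first.
- by rewrite -size_poly_eq0 size2.
- by apply/prodf_neq0 => g _; rewrite -size_poly_eq0 size2.
rewrite size2 /= ltnS size_poly_gt0; apply/prodf_neq0 => g _.
by rewrite -size_poly_eq0 size2.
Qed.

(* An invariant polynomial f of least positive degree in x generates L[x]^G   *)
(* over L^G: by uniqueness, quotient and remainder of the Euclidean division  *)
(* of an invariant polynomial by f are again invariant.                       *)
Lemma affine_invariants : exists f, [/\ f \in adjoin L [:: x],
  f \notin algcl L, forall g, act g f = f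
  & invariants (adjoin L [:: x]) =i adjoin (invariants L) [:: f]].
Proof.
have exn : exists n, `[< exists p, [/\ inv p, (1 < size p)%N & size p = n] >].
  by have [p [ip sp]] := exists_invariant; exists (size p); apply/asboolP; exists p.
have [_ /asboolP[f [[fL f_inv] f1 <-]] f_min] := ex_minnP exn.
have {}f_min p : inv p -> (1 < size p)%N -> (size f <= size p)%N.
  by move=> ip sp; apply: f_min; apply/asboolP; exists p.
have f0 : f != 0 by rewrite -size_poly_gt0 ltnW.
have xin : x \in adjoin L [:: x] by apply: mem_adjoin; rewrite inE.
have sub_in : {subset L <= adjoin L [:: x]} by apply: sub_adjoin.
have inv_gen n (p : {poly F}) : (size p <= n)%N -> inv p ->
    p.[x] \in adjoin (invariants L) [:: f.[x]].
  elim: n p => [|n IHn] p.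
    by rewrite leqn0 size_poly_eq0 => /eqP-> _; rewrite horner0 rpred0.
  move=> sp [pL p_inv]; have [p1|p1] := leqP (size p) 1.
    have [c def_p] : exists c, p = c%:P by exists p`_0; apply: size1_polyC.
    have cL : c \in L by rewrite -(polyOverC L) -def_p.
    apply: sub_adjoin; rewrite def_p hornerC; apply/invariantsP; split=> // g.
    by have := p_inv g; rewrite def_p hornerC.
  pose q := p %/ f; pose r := p %% f.
  have [qL rL] : q \is a polyOver L /\ r \is a polyOver L by apply: polyOver_divp_modp.
  have def_p : p = q * f + r by apply: divp_eq.
  have rf : (size r < size f)%N by rewrite ltn_modp.
  have qr_inv g : act g q.[x] = q.[x] /\ act g r.[x] = r.[x].
    have [q' [q'L q's q'g]] := act_poly g qL.
    have [r' [r'L r's r'g]] := act_poly g rL.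
    have e0 : (q' - q) * f + (r' - r) = 0.
      apply: (@transcendental_eq0 L x) => //; first by rewrite !(rpredD, rpredM, rpredN).
      rewrite !(hornerD, hornerM, hornerN) -q'g -r'g mulrBl addrACA -opprD.
      rewrite -[X in act _ _ * X](f_inv g).
      by rewrite -rmorphM -rmorphD -hornerM -hornerD -def_p p_inv subrr.
    have q'q : q' - q = 0.
      apply: contraTeq (leq_ltn_trans r's rf) => qq0; rewrite -leqNgt.
      have : (size f <= size (r' - r)%R)%N.
        have -> : r' - r = - ((q' - q) * f) by apply/eqP; rewrite -addr_eq0 addrC e0.
        rewrite size_polyN size_mul //.
        by rewrite -(@prednK (size (q' - q)%R)) ?size_poly_gt0 //= leq_addl.
      move=> /leq_trans/(_ (size_polyD _ _)); rewrite size_polyN leq_max.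
      by rewrite [X in _ || X]leqNgt rf orbF.
    move: e0; rewrite q'q mul0r add0r => /subr0_eq r'r.
    by move/subr0_eq: q'q => q'q; rewrite q'g r'g q'q r'r.
  rewrite def_p hornerD hornerM; apply: rpredD; last first.
    have r_inv : inv r by split=> // g; case: (qr_inv g).
    apply: IHn => //; have [r1|/(f_min _ r_inv)] := leqP (size r) 1.
      by rewrite (leq_trans r1) // -ltnS (leq_trans p1).
    by rewrite leqNgt rf.
  apply: rpredM; last by apply: mem_adjoin; rewrite inE.
  apply: IHn; last by split=> // g; case: (qr_inv g).
  rewrite -ltnS (leq_trans _ sp) // size_divp // ltn_subrL.
  by rewrite -subn1 subn_gt0 f1 (leq_trans _ p1).
exists f.[x]; split=> // [||z].
- exact: (horner_mem sub_in).
(* An equation for f(x) composed with the nonconstant f would be an equation for x. *)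
- apply/negP => /algclP[P [PL P0 /rootP Pf]].
  have PfL : P \Po f \is a polyOver L by apply: polyOver_comp.
  have := transcendental_eq0 xL PfL; rewrite horner_comp => /(_ Pf)/eqP.
  by rewrite comp_poly_eq0 ?(negPf P0) ?f1.
apply/idP/idP => [/invariantsP[zx fz]|].
  have [||p [q [pL qL q0 -> pq]]] := @invariant_fraction [set: gT]%G L x z _ zx.
  - by move=> g p _ /(act_poly g)[q [qL _ ->]]; exists q.
  - by move=> g _; apply: fz.
  by rewrite rpred_div //; apply: inv_gen => //; split=> // g;
     have [] := pq g (in_setT g).
apply: adjoin_min => {}z.
  by move=> /invariantsP[zL fz]; apply/invariantsP; split=> //; apply: sub_in.
by rewrite inE => /eqP->; apply/invariantsP; split=> //; apply: (horner_mem sub_in).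
Qed.

End AffineVariable.

Fixpoint affine_tower L xs : Prop :=
  if xs is x :: xs' then
    (forall g, exists a b, [/\ a \in L, b \in L & act g x = a * x + b])
    /\ affine_tower (adjoin L [:: x]) xs'
  else True.

(** Induction with L(x) as the new base: its invariants are L^G(f) by [affine_invariants], so f is
    put in front of the generators found for the rest. Faithfulness of the action never enters, so
    this applies to subfields on which part of the group is trivial. *)
Lemma affine_tower_invariants L xs : act_stable L -> tower L xs -> affine_tower L xs ->
  exists fs, [/\ size fs = size xs, tower (invariants L) fs
    & invariants (adjoin L xs) =i adjoin (invariants L) fs].
Proof.
elim: xs L => [|x xs IHxs] L Ls /=.
  exists [::]; split=> // z; rewrite adjoin_nil.
  by apply/invariantsP/invariantsP; rewrite adjoin_nil.
move=> [xL txs] [xa axs]; have [f [fx fL finv fE]] := affine_invariants Ls xL xa.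
have Lxs : act_stable (adjoin L [:: x]).
  apply: act_stable_adjoin => // g y; rewrite inE => /eqP->.
  have [a [b [aL bL ->]]] := xa g.
  have xin : x \in adjoin L [:: x] by apply: mem_adjoin; rewrite inE.
  by rewrite rpredD ?rpredM //; apply: sub_adjoin.
have [fs [sfs tfs fsE]] := IHxs _ Lxs txs axs.
exists (f :: fs); split=> [|/=|z]; first by rewrite /= sfs.
  split; last by apply: tower_sub tfs => z; rewrite fE.
  by apply: contra fL; apply: algcl_sub => z /invariantsP[].
rewrite adjoin_cons -(eq_adjoin fE (frefl _ : fs =i fs)) -fsE.
by apply/invariantsP/invariantsP; rewrite adjoin_cons.
Qed.

End Action.

(** * Purely transcendental extensions *)

Section FractionExtension.
Variables (R : idomainType) (F : fieldType) (f : {rmorphism R -> F}).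
Hypothesis f_inj : injective f.

Definition frac_ext (x : {fraction R}) : F := f \n_(repr x) / f \d_(repr x).

Let f_eq0 a : (f a == 0) = (a == 0).
Proof. by rewrite -(inj_eq f_inj) rmorph0. Qed.

Lemma frac_ext_div a b : b != 0 -> frac_ext (a%:F / b%:F) = f a / f b.
Proof.
move=> b0; rewrite /frac_ext; set x := a%:F / b%:F.
have d0 := denom_ratioP (repr x).
apply/eqP; rewrite eqr_div ?f_eq0 // -!rmorphM (inj_eq f_inj).
by rewrite -tofrac_eq !tofracM -eqr_div ?tofrac_eq0 // -frac_numden.
Qed.

Lemma frac_ext_tofrac a : frac_ext a%:F = f a.
Proof.
by rewrite -[a%:F]divr1 -tofrac1 frac_ext_div ?oner_neq0 // rmorph1 divr1.
Qed.

Lemma frac_ext_zmod_morphism : zmod_morphism frac_ext.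
Proof.
move=> x y; rewrite [x in LHS]frac_numden [y in LHS]frac_numden [in RHS]/frac_ext.
have x0 := denom_ratioP (repr x); have y0 := denom_ratioP (repr y).
rewrite -!mulNr !addf_div ?f_eq0 ?tofrac_eq0 //.
rewrite -!tofracN -!tofracM -!tofracD frac_ext_div ?mulf_neq0 //.
by rewrite !(rmorphM, rmorphD, rmorphN).
Qed.

Lemma frac_ext_monoid_morphism : monoid_morphism frac_ext.
Proof.
split=> [|x y]; first by rewrite -tofrac1 frac_ext_tofrac rmorph1.
rewrite [x in LHS]frac_numden [y in LHS]frac_numden.
have x0 := denom_ratioP (repr x); have y0 := denom_ratioP (repr y).
rewrite mulf_div -!tofracM frac_ext_div ?mulf_neq0 //.
by rewrite [in RHS]/frac_ext mulf_div !rmorphM.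
Qed.

End FractionExtension.

Lemma mpoly_rmorph_ext n (R : nzRingType) (S : comNzRingType)
    (f g : {rmorphism {mpoly R[n]} -> S}) :
  (forall c, f c%:MP = g c%:MP) -> (forall i, f 'X_i = g 'X_i) -> f =1 g.
Proof.
move=> fgC fgX p; rewrite (mpolyE p) !rmorph_sum; apply: eq_bigr => m _.
rewrite -mul_mpolyC !rmorphM fgC; congr (_ * _).
rewrite mpolyXE_id !rmorph_prod; apply: eq_bigr => i _.
by rewrite !rmorphXn fgX.
Qed.

Section Univariate.
Variables (n : nat) (R : comNzRingType).

Lemma muni_widen (i : 'I_n) :
  muni ('X_(widen_ord (leqnSn n) i) : {mpoly R[n.+1]}) = ('X_i)%:P.
Proof.
rewrite muniE msuppX big_seq1 mcoeffX eqxx scale1r.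
have -> : (U_(widen_ord (leqnSn n) i) : 'X_{1..n.+1})%MM ord_max = 0%N.
  by rewrite mnm1E -val_eqE /= ltn_eqF.
rewrite expr0 alg_polyC; congr ('X_[_])%:P.
by apply/mnmP => j; rewrite !mnmE -!val_eqE.
Qed.

Lemma muni_max : muni ('X_ord_max : {mpoly R[n.+1]}) = 'X.
Proof.
rewrite muniE msuppX big_seq1 mcoeffX eqxx scale1r mnm1E eqxx expr1.
have -> : [multinom (U_(ord_max) : 'X_{1..n.+1})%MM
            (widen_ord (leqnSn n) i) | i < n] = 0%MM.
  by apply/mnmP => j; rewrite !mnmE -val_eqE /= gtn_eqF.
by rewrite mpolyX0 scale1r.
Qed.

End Univariate.

(** * Towers over the constants as injective polynomial evaluations *)

Section PurelyTranscendental.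
Variables (K F : fieldType) (iota : {rmorphism K -> F}).
Implicit Types (x z : F) (xs : seq F).

Definition constants : {pred F} := fun z => `[< exists c, z = iota c >].

Lemma constants_divring_closed : divring_closed constants.
Proof.
split=> [|_ _ /asboolP[a ->] /asboolP[b ->]|_ _ /asboolP[a ->] /asboolP[b ->]];
  apply/asboolP.
- by exists 1; rewrite rmorph1.
- by exists (a - b); rewrite rmorphB.
- by exists (a / b); rewrite fmorph_div.
Qed.

HB.instance Definition _ :=
  GRing.isDivringClosed.Build F constants constants_divring_closed.

Lemma mem_constants c : iota c \in constants.
Proof. by apply/asboolP; exists c. Qed.

Definition ev n xs : {mpoly K[n]} -> F := mmap iota (fun i => xs`_i).

HB.instance Definition _ n xs := GRing.RMorphism.copy (@ev n xs)
  (mmap iota (fun i : 'I_n => xs`_i)).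

Lemma evC n xs c : ev xs (c%:MP_[n]) = iota c.
Proof. exact: mmapC. Qed.

Lemma evX n xs i : ev xs ('X_i : {mpoly K[n]}) = xs`_i.
Proof. by rewrite /ev mmapX mmap1U. Qed.

Lemma ev_mem n xs (L : divringClosed F) (p : {mpoly K[n]}) : (n <= size xs)%N ->
  {subset constants <= L} -> {subset xs <= L} -> ev xs p \in L.
Proof.
move=> sn cL xL; rewrite /ev /mmap; apply: rpred_sum => m _.
apply: rpredM; first exact/cL/mem_constants.
by apply: rpred_prod => i _; rewrite rpredX // xL // mem_nth // (leq_trans _ sn).
Qed.

Definition ev_quotients n xs : {pred F} := fun z =>
  `[< exists p q : {mpoly K[n]}, ev xs q != 0 /\ z = ev xs p / ev xs q >].

Lemma ev_quotients_divring_closed n xs : divring_closed (ev_quotients n xs).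
Proof.
split=> [|y z /asboolP[p][q][q0 ->] /asboolP[p'][q'][q'0 ->]
         |y z /asboolP[p][q][q0 ->] /asboolP[p'][q'][q'0 ->]];
  apply/asboolP.
- by exists 1, 1; rewrite rmorph1 oner_neq0 divr1.
- exists (p * q' - p' * q), (q * q').
  split; first by rewrite rmorphM mulf_neq0.
  by rewrite rmorphB !rmorphM -[in LHS]mulNr addf_div // mulNr.
- have [p'0|p'0] := eqVneq (ev xs p') 0.
    by exists 0, 1; rewrite rmorph1 oner_neq0 p'0 rmorph0 !mul0r invr0 mulr0.
  exists (p * q'), (q * p').
  split; first by rewrite rmorphM mulf_neq0.
  by rewrite !rmorphM invf_div mulf_div.
Qed.

HB.instance Definition _ n xs := GRing.isDivringClosed.Build F
  (ev_quotients n xs) (ev_quotients_divring_closed n xs).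

Lemma adjoin_constantsP n xs z : size xs = n ->
  reflect (exists p q : {mpoly K[n]}, ev xs q != 0 /\ z = ev xs p / ev xs q)
          (z \in adjoin constants xs).
Proof.
move=> sn; apply: (iffP idP) => [zg|[p [q [q0 ->]]]]; last first.
  by rewrite rpred_div //; apply: ev_mem; rewrite ?sn //;
    [apply: sub_adjoin | apply: mem_adjoin | apply: sub_adjoin | apply: mem_adjoin].
suff/asboolP : z \in ev_quotients n xs by [].
apply: adjoin_min zg => {}z.
  move=> /asboolP[c ->]; apply/asboolP; exists (c%:MP), 1.
  by rewrite rmorph1 evC oner_neq0 divr1.
move=> zin; have iz : (index z xs < n)%N by rewrite -sn index_mem.
apply/asboolP; exists 'X_(Ordinal iz), 1.
by rewrite rmorph1 evX oner_neq0 divr1 /= nth_index.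
Qed.

Lemma ev_take n xs (p : {mpoly K[n]}) : ev xs p = ev (take n xs) p.
Proof.
by apply: (mpoly_rmorph_ext (f := ev xs) (g := ev (take n xs))) p => [c|i];
  rewrite /= ?evC ?evX ?nth_take.
Qed.

Lemma ev_muni n xs (p : {mpoly K[n.+1]}) :
  ev xs p = (map_poly (ev xs) (muni p)).[xs`_n].
Proof.
pose g := horner_eval xs`_n \o (map_poly (@ev n xs) \o @muni n K).
apply: (mpoly_rmorph_ext (f := ev xs) (g := g)) p => [c|i] /=.
  by rewrite muniC map_polyC /horner_eval hornerC /= !evC.
rewrite /horner_eval evX; have [j ->|->] := unliftP ord_max i.
  have -> : lift ord_max j = widen_ord (leqnSn n) j.
    by apply: val_inj; rewrite /= /bump leqNgt ltn_ord.
  by rewrite muni_widen map_polyC hornerC /= evX.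
by rewrite muni_max map_polyX hornerX.
Qed.

Lemma mmulti_muni n (p : {mpoly K[n.+1]}) :
  (map_poly (@mwiden n K) (muni p)).['X_ord_max] = p.
Proof.
pose g := horner_eval ('X_ord_max : {mpoly K[n.+1]}) \o (map_poly (@mwiden n K) \o @muni n K).
apply: (mpoly_rmorph_ext (f := g) (g := idfun)) p => [c|i] /=.
  by rewrite muniC map_polyC /horner_eval hornerC /= mwidenC.
rewrite /horner_eval; have [j ->|->] := unliftP ord_max i.
  have -> : lift ord_max j = widen_ord (leqnSn n) j.
    by apply: val_inj; rewrite /= /bump leqNgt ltn_ord.
  by rewrite muni_widen map_polyC hornerC /= mwidenX mnmwiden1.
by rewrite muni_max map_polyX hornerX.
Qed.

Lemma muni_mwiden n (p : {mpoly K[n]}) : muni (mwiden p) = p%:P.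
Proof.
pose g := @muni n K \o @mwiden n K.
apply: (mpoly_rmorph_ext (f := g) (g := polyC)) p => [c|i] /=.
  by rewrite mwidenC muniC.
by rewrite mwidenX mnmwiden1 muni_widen.
Qed.

Lemma muni_mmulti n (q : {poly {mpoly K[n]}}) :
  muni (map_poly (@mwiden n K) q).['X_ord_max] = q.
Proof.
rewrite -horner_map /= muni_max -map_poly_comp.
by rewrite (eq_map_poly (@muni_mwiden n)) -[RHS]comp_polyXr.
Qed.

(** Induction peeling off the last variable with [muni]: a relation among n+1 elements is a
    one-variable equation for the last over the field of the others, and conversely such an equation
    becomes a polynomial relation after its coefficients are put over a common denominator. *)
Lemma tower_constantsP n xs : size xs = n ->
  tower constants xs <-> (forall p : {mpoly K[n]}, ev xs p = 0 -> p = 0).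
Proof.
elim: n xs => [|n IHn] xs sn.
  case: xs sn => // _; split=> // _ p.
  have [c ->] : exists c, p = c%:MP.
    exists p@_0%MM; apply/mpolyP => m; rewrite mcoeffC.
    have -> : m = 0%MM by apply/mnmP; case.
    by rewrite eqxx mulr1.
  by rewrite evC => /eqP; rewrite fmorph_eq0 => /eqP->; rewrite mpolyC0.
case/lastP: xs sn => // xs x; rewrite size_rcons => -[sn].
rewrite -cats1 tower_cat IHn //=.
have evE (p : {mpoly K[n]}) : ev (xs ++ [:: x]) p = ev xs p.
  by rewrite ev_take take_size_cat.
have ev_muni' p : ev (xs ++ [:: x]) p = (map_poly (ev xs) (@muni n K p)).[x].
  by rewrite ev_muni (eq_map_poly evE) nth_cat sn ltnn subnn.
split=> [[xsi [xg _]] p|xi].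
  rewrite ev_muni' => p0.
  have {p0} mp0 : map_poly (ev xs) (muni p) = 0.
    apply: contraNeq xg => mp0; apply/algclP; exists (map_poly (ev xs) (muni p)).
    split=> //; last exact/rootP.
    apply/polyOverP => i; rewrite coef_map.
    by apply: ev_mem; rewrite ?sn //; [apply: sub_adjoin | apply: mem_adjoin].
  rewrite -[p]mmulti_muni.
  suff -> : muni p = 0 by rewrite map_poly0 horner0.
  apply/polyP => i; rewrite coef0; apply: xsi.
  by move/polyP/(_ i): mp0; rewrite coef_map coef0.
have xsi (p : {mpoly K[n]}) : ev xs p = 0 -> p = 0.
  move=> p0; have /inj_mwiden // : mwiden p = mwiden 0.
  rewrite mwiden0; apply: xi; rewrite ev_muni'.
  by rewrite muni_mwiden map_polyC hornerC.
do 2!split=> //; apply/negP => /algclP[p [pL p0 /rootP px]].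
pose R z := exists q : {mpoly K[n]}, z = ev xs q.
have [||i _|b [[b' def_b] b0 bp]] := @common_denominator _ R (size p) (fun i => p`_i).
- by exists 1; rewrite rmorph1.
- by move=> _ _ [q ->] [r ->]; exists (q * r); rewrite rmorphM.
- have /(adjoin_constantsP _ sn)[q [r [r0 ->]]] := polyOverP pL i.
  by exists (ev xs q), (ev xs r); split=> //; [exists q | exists r].
have {}bp (i : 'I_(size p)) : {q : {mpoly K[n]} | b * p`_i = ev xs q}.
  by apply: cid; apply: bp.
pose c i := sval (bp i).
pose q : {poly {mpoly K[n]}} := \poly_(k < size p) (if insub k is Some i then c i else 0).
have qE : map_poly (ev xs) q = b *: p.
  apply/polyP => k; rewrite coef_map coef_poly coefZ.
  case: ltnP => [ltk|lek]; last by rewrite raddf0 nth_default ?mulr0.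
  by rewrite insubT /= /c -(svalP (bp (Sub k ltk))).
have q0 : q = 0.
  rewrite -(muni_mmulti q); have -> : (map_poly (@mwiden n K) q).['X_ord_max] = 0.
    by apply: xi; rewrite ev_muni' muni_mmulti qE hornerZ px mulr0.
  by rewrite muni0.
by move/eqP: qE; rewrite q0 rmorph0 eq_sym scaler_eq0 (negPf b0) (negPf p0).
Qed.

End PurelyTranscendental.

(** Evaluation at an independent family is injective, so it extends to the fraction field; its image
    is all of [S] because every element of [S] is a quotient of values. *)
Lemma rational_of_tower (K F : fieldType) (iota : {rmorphism K -> F})
    (S : divringClosed F) (h : {rmorphism K -> subfield S}) (xs : seq F) :
  (forall c, val (h c) = iota c) -> tower (constants iota) xs ->
  S =i adjoin (constants iota) xs -> rational_over h.
Proof.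
move=> hE txs SE; pose n := size xs.
have ev_inj : injective (@ev _ _ iota n xs).
  by apply: raddf_inj; apply/tower_constantsP.
have ev_S (x : ratfun K n) : frac_ext (@ev _ _ iota n xs) x \in S.
  rewrite SE; apply/(adjoin_constantsP _ _ (erefl n)).
  exists (\n_(repr x)), (\d_(repr x)); split=> //.
  by rewrite (raddf_eq0 _ ev_inj) denom_ratioP.
pose phi (x : ratfun K n) : subfield S := exist (fun z => z \in S) _ (ev_S x).
have phi_zmod : zmod_morphism phi.
  by move=> x y; apply: val_inj; rewrite /= frac_ext_zmod_morphism.
have phi_mon : monoid_morphism phi.
  have [e1 eM] := frac_ext_monoid_morphism ev_inj.
  by split=> [|x y]; apply: val_inj; rewrite /= ?e1 ?eM.
pose phiA := GRing.isZmodMorphism.Build _ _ phi phi_zmod.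
pose phiM := GRing.isMonoidMorphism.Build _ _ phi phi_mon.
pose phi' : {rmorphism ratfun K n -> subfield S} := HB.pack phi phiA phiM.
exists n, phi'; split=> [|c]; last first.
  apply: val_inj; rewrite hE -[RHS](evC iota n xs).
  exact: (frac_ext_tofrac ev_inj).
have phi_surj (y : subfield S) : exists x, phi x == y.
  have := valP y; rewrite [_ \in _]SE => /(adjoin_constantsP _ _ (erefl n)).
  move=> [p [q [q0 yE]]]; exists (p%:F / q%:F); apply/eqP/val_inj.
  by rewrite /= yE frac_ext_div // -(raddf_eq0 _ ev_inj).
exists (fun y => xchoose (phi_surj y)) => [x|y].
  by apply: (fmorph_inj phi'); apply/eqP: (xchooseP (phi_surj (phi x))).
by apply/eqP: (xchooseP (phi_surj y)).
Qed.

(** * Linear actions of p-groups *)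

(** A fixed vector of the p-group on the nonzero quotient module by [U], lifted back: the inductive
    step in building a stable flag. *)
Lemma pgroup_fixed_mod (K : fieldType) (gT : finGroupType) (G : {group gT})
    (p n : nat) (rG : mx_representation K G n) (U : 'M[K]_n) :
  p \in [pchar K] -> (p.-group G)%g -> mxmodule rG U -> (\rank U < n)%N ->
  exists v : 'rV_n, ~~ (v <= U)%MS /\
    forall g, g \in G -> (v *m rG g - v <= U)%MS.
Proof.
move=> chp pG Umod rkU; set rQ := factmod_repr Umod.
have rk_gt0 : (0 < \rank (cokermx U))%N by rewrite mxrank_coker subn_gt0.
have fix0 : rfix_mx rQ G != 0 by apply: (rfix_pgroup_pchar chp rQ rk_gt0 pG (subxx _)).
have /rowV0Pn[w w_fix w0] := fix0.
exists (val_factmod w); split=> [|g gG].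
  by rewrite -in_factmod_eq0 val_factmodK.
rewrite -in_factmod_eq0 linearB /= in_factmodJ // val_factmodK.
by have /rfix_mxP/(_ g gG)-> := w_fix; rewrite subrr.
Qed.

Section LinearAction.
Variables (K F : fieldType) (iota : {rmorphism K -> F}).
Variables (gT : finGroupType) (act : gT -> {rmorphism F -> F}) (x : gT -> F).
Hypothesis act1 : forall z, act 1%g z = z.
Hypothesis actM : forall g h z, act (g * h)%g z = act g (act h z).
Hypothesis act_iota : forall g c, act g (iota c) = iota c.
Hypothesis act_x : forall g h, act g (x h) = x (g * h)%g.

Local Notation k := (constants iota).
Local Notation N := #|gT|.

Lemma act_stable_constants : act_stable act k.
Proof. by move=> g _ /asboolP[c ->]; rewrite act_iota mem_constants. Qed.

Lemma invariants_constants : invariants act k =i k.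
Proof.
move=> z; apply/idP/idP => [/invariantsP[]//|zk]; apply/invariantsP; split=> // g.
by have /asboolP[c ->] := zk; rewrite act_iota.
Qed.

Definition lin (v : 'rV[K]_N) : F := \sum_i iota (v 0 i) * x (enum_val i).

Lemma lin_zmod_morphism : zmod_morphism lin.
Proof.
move=> u v; rewrite /lin -sumrB; apply: eq_bigr => i _.
by rewrite !mxE rmorphB mulrBl.
Qed.

HB.instance Definition _ := GRing.isZmodMorphism.Build _ _ lin lin_zmod_morphism.

Lemma linZ c v : lin (c *: v) = iota c * lin v.
Proof.
rewrite /lin mulr_sumr; apply: eq_bigr => i _.
by rewrite !mxE rmorphM mulrA.
Qed.

Lemma lin_delta h : lin (delta_mx 0 (enum_rank h)) = x h.
Proof.
rewrite /lin (bigD1 (enum_rank h)) //= big1 => [|i hi].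
  by rewrite mxE !eqxx rmorph1 mul1r addr0 enum_rankK.
by rewrite mxE eqxx (negPf hi) rmorph0 mul0r.
Qed.

Lemma lin_span m (A : 'M[K]_(m, N)) (v : 'rV_N) (L : divringClosed F) :
  {subset k <= L} -> (forall i, lin (row i A) \in L) -> (v <= A)%MS -> lin v \in L.
Proof.
move=> kL AL /submxP[u ->]; rewrite mulmx_sum_row raddf_sum.
apply: rpred_sum => i _; rewrite /= linZ rpredM //.
exact/kL/mem_constants.
Qed.

Definition left_mx (g : gT) : 'M[K]_N :=
  \matrix_(i, j) (enum_rank (g * enum_val i)%g == j)%:R.

Lemma row_left_mx g i : row i (left_mx g) = delta_mx 0 (enum_rank (g * enum_val i)%g).
Proof. by apply/rowP => j; rewrite !mxE eqxx eq_sym. Qed.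

Lemma act_lin g v : act g (lin v) = lin (v *m left_mx g).
Proof.
rewrite mulmx_sum_row [RHS]raddf_sum [in LHS]/lin rmorph_sum.
apply: eq_bigr => i _; rewrite [RHS]linZ row_left_mx lin_delta.
by rewrite rmorphM act_iota act_x.
Qed.

Lemma left_mxM g h : left_mx (g * h) = left_mx h *m left_mx g.
Proof.
apply/row_matrixP => i; rewrite row_mul !row_left_mx -rowE row_left_mx.
by rewrite enum_rankK mulgA.
Qed.

Lemma left_mx1 : left_mx 1 = 1%:M.
Proof.
by apply/row_matrixP => i; rewrite row_left_mx mul1g enum_valK row1.
Qed.

(** On row vectors [left_mx] reverses products ([left_mxM]), and the inverse restores the order. *)
Lemma left_mx_repr : mx_repr [set: gT] (fun g => left_mx g^-1%g).
Proof.
by split=> [|g h _ _]; rewrite ?invg1 ?left_mx1 // invMg left_mxM.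
Qed.

Definition left_repr := MxRepresentation left_mx_repr.

Lemma affine_tower_cat L xs ys : affine_tower act L xs ->
  affine_tower act (adjoin L xs) ys -> affine_tower act L (xs ++ ys).
Proof.
have sub (M M' : divringClosed F) zs : {subset M <= M'} ->
    affine_tower act M zs -> affine_tower act M' zs.
  elim: zs M M' => //= z zs IHzs M M' MM' [za azs]; split.
    by move=> g; have [a [b [/MM' aM /MM' bM gz]]] := za g; exists a, b.
  by apply: IHzs azs; apply: adjoin_sub.
elim: xs L => [|z zs IHzs] L /=.
  by move=> _; apply: sub => u; rewrite adjoin_nil.
move=> [za azs] ays; split=> //; apply: IHzs => //.
by apply: sub ays => u; rewrite adjoin_cons.
Qed.

Lemma pgroup_affine_tower p : p \in [pchar K] -> (p.-group [set: gT])%g ->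
  exists ys, [/\ size ys = N, affine_tower act k ys
    & forall h, x h \in adjoin k ys].
Proof.
move=> chp pG.
suff flag m : (m <= N)%N -> exists ys (U : 'M[K]_N), [/\ size ys = m,
    \rank U = m, mxmodule left_repr U, affine_tower act k ys
    & forall v : 'rV_N, (v <= U)%MS -> lin v \in adjoin k ys].
  have [ys [U [sys rkU _ ays yU]]] := flag N (leqnn _).
  exists ys; split=> // h; rewrite -lin_delta; apply: yU; apply: submx_full.
  by rewrite /row_full rkU.
elim: m => [|m IHm] leN.
  exists [::], 0; split=> //; rewrite ?mxrank0 ?mxmodule0 // => v.
  by rewrite submx0 => /eqP->; rewrite raddf0 rpred0.
have [ys [U [sys rkU Umod ays yU]]] := IHm (ltnW leN).
have [|v [vU gv]] := pgroup_fixed_mod chp pG Umod; first by rewrite rkU.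
exists (rcons ys (lin v)), (U + v)%MS; split.
- by rewrite size_rcons sys.
- apply/eqP; rewrite eqn_leq; apply/andP; split.
    rewrite (leq_trans (mxrank_adds_leqif U v)) // rkU -[m.+1]addn1 leq_add2l.
    exact: rank_leq_row.
  rewrite -[X in (X < _)%N]rkU; apply: rank_ltmx.
  by rewrite ltmxE addsmxSl addsmx_sub submx_refl.
- apply/mxmoduleP => g gG; rewrite addsmxMr addsmx_sub.
  rewrite (submx_trans (mxmoduleP Umod g gG)) ?addsmxSl //=.
  rewrite -[v *m _](subrK v) addmx_sub ?addsmxSr //.
  by rewrite (submx_trans (gv g gG)) ?addsmxSl.
- rewrite -cats1; apply: affine_tower_cat => //; split=> // g.
  (* v is fixed modulo U, so g translates its linear form by a form from U, already in the field
     below. *)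
  exists 1, (lin (v *m left_repr g^-1%g - v)); split; first exact: rpred1.
    by apply: yU; apply: gv; rewrite inE.
  by rewrite mul1r raddfB /= invgK -act_lin addrC subrK.
move=> w; rewrite addsmxE => /lin_span; apply; first exact: sub_adjoin.
move=> i; rewrite -cats1 adjoin_cat; case: (split_ordP i) => j ->.
  by rewrite rowKu; apply: sub_adjoin; apply: yU; rewrite row_sub.
by rewrite rowKd ord1 row_id; apply: mem_adjoin; rewrite inE.
Qed.

End LinearAction.

(** * Simultaneous diagonalisation of an abelian group *)

Lemma finite_order_diagonalizable (K : fieldType) n (A : 'M[K]_n) q (z : K) :
  q.-primitive_root z -> iter q (mulmx A) 1%:M = 1%:M -> diagonalizable A.
Proof.
move=> zq; case: n A => [|n] A Aq.
  by exists 1%:M; rewrite ?unitmx1 //; apply/is_diag_mxP => -[].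
apply/diagonalizableP; exists [seq z ^+ i | i <- iota 0 q].
  rewrite map_inj_in_uniq ?iota_uniq // => i j.
  rewrite !mem_iota !add0n /= => ltiq ltjq /eqP.
  by rewrite (eq_prim_root_expr zq) !modn_small // => /eqP.
set P := \prod_(_ <- _) _.
have -> : P = 'X^q - 1.
  by rewrite -(factor_Xn_sub_1 zq) /index_iota subn0 /P big_map.
apply: mxminpoly_min; rewrite rmorphB rmorphXn rmorph1 /= horner_mx_X.
suff -> : A ^+ q = iter q (mulmx A) 1%:M by rewrite Aq subrr.
by elim: q {zq Aq P} => // q IHq; rewrite exprS IHq.
Qed.

Section Eigenbasis.
Variables (K F : fieldType) (iota : {rmorphism K -> F}).
Variables (gT : finGroupType) (act : gT -> {rmorphism F -> F}) (x : gT -> F).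
Hypothesis act_iota : forall g c, act g (iota c) = iota c.
Hypothesis act_x : forall g h, act g (x h) = x (g * h)%g.
Hypothesis gT_abelian : forall g h : gT, (g * h = h * g)%g.

Lemma iter_left_mx (g : gT) m :
  iter m (mulmx (left_mx K g)) 1%:M = left_mx K (g ^+ m)%g.
Proof.
elim: m => [|m IHm]; first by rewrite expg0 left_mx1.
by rewrite iterS IHm expgSr left_mxM.
Qed.

(** The matrices of the regular representation commute and each is annihilated by X^q - 1, which has
    q distinct roots in K; hence they are codiagonalizable, and the rows of the base change give the
    u_i. *)
Lemma abelian_eigenbasis q (z : K) :
  q.-primitive_root z -> (forall g : gT, g ^+ q = 1)%g ->
  exists u : 'I_#|gT| -> F,
    (forall i g, exists c, act g (u i) = iota c * u i) /\
    (forall h, x h \in adjoin (constants iota) (codom u)).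
Proof.
move=> zq gq; pose A := @left_mx K gT.
have [P Pu /allP Pd] : codiagonalizable [seq A g | g <- enum gT].
  apply/codiagonalizableP.
  split=> [_ _ /mapP[g _ ->] /mapP[h _ ->]|_ /mapP[g _ ->]].
    by rewrite /comm_mx -!left_mxM gT_abelian.
  by apply: finite_order_diagonalizable zq _; rewrite iter_left_mx gq left_mx1.
exists (fun i => lin iota x (row i P)); split=> [i g|h].
  have /Pd/= : A g \in [seq A g | g <- enum gT] by rewrite map_f ?mem_enum.
  move=> /diagonalizable_forPex[d /(simmxP Pu) PA]; exists (d 0 i).
  rewrite (act_lin act_iota act_x) -row_mul PA -linZ; congr lin.
  by rewrite row_mul row_diag_mx -scalemxAl -rowE.
rewrite -(lin_delta iota x); apply: (lin_span (A := P)).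
- exact: sub_adjoin.
- by move=> i; apply: mem_adjoin; apply: codom_f.
by apply: submx_full; rewrite row_full_unit.
Qed.

End Eigenbasis.

(** * Cyclic families of eigenvectors *)

(** By nilpotency [D, G] is proper in D; any maximal subgroup [D0] of D above it is normal in G, has
    index p in D, and makes D / D0 central in G / D0. *)
Lemma central_step (p : nat) (gT : finGroupType) (D : {group gT}) :
  (p.-group [set: gT])%g -> (D <| [set: gT])%g -> D :!=: 1%g ->
  exists (D0 : {group gT}) d,
    [/\ D0 <| [set: gT], D0 \proper D, d \in D, (d ^+ p)%g \in D0
      & (forall g, [~ d, g]%g \in D0) /\ D \subset D0 <*> <[d]> ]%g.
Proof.
move=> pG nDG nt; have pD : (p.-group D)%g := pgroupS (normal_sub nDG) pG.
have prDG : ([~: D, [set: gT]] \proper D)%g.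
  apply: (nil_comm_properl (pgroup_nil pG)) (normal_sub nDG) nt _.
  by rewrite subsetI subxx normal_norm.
have [eqD|[D0 maxD0 sD0]] := maximal_exists (proper_sub prDG).
  by move: prDG; rewrite eqD properxx.
have sD : D0 \proper D := maxgroupp maxD0.
have [sD0D [d dD dD0]] := properP sD.
have commD0 g : ([~ d, g] \in D0)%g.
  by apply: (subsetP sD0); rewrite mem_commg ?inE.
have nD0D := p_maximal_normal pD maxD0.
exists D0, d; split=> //.
- rewrite /normal subsetT -commg_subl (subset_trans _ sD0) //.
  by rewrite commSg.
- rewrite coset_idr ?groupX ?(subsetP (normal_norm nD0D)) //.
  rewrite morphX ?(subsetP (normal_norm nD0D)) //.
  rewrite -(p_maximal_index pD maxD0) -card_quotient ?normal_norm //.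
  by apply: expg_cardG; apply: mem_quotient.
split=> //; have [/maxgroupP[_ maxD]] := maxD0.
have sJ : (D0 <*> <[d]> \subset D)%g by rewrite join_subG sD0D cycle_subG.
apply: contraR dD0 => nsJ.
have <- : (D0 <*> <[d]>)%g = D0.
  apply: (maxD [group of (D0 <*> <[d]>)%g]); last exact: joing_subl.
  by rewrite properE sJ.
by rewrite (subsetP (joing_subr _ _)) ?cycle_id.
Qed.

Section Monomial.
Variables (F : fieldType) (gT : finGroupType) (act : gT -> {rmorphism F -> F}).
Hypothesis act1 : forall x, act 1%g x = x.
Hypothesis actM : forall g h x, act (g * h)%g x = act g (act h x).
Variables (k : divringClosed F) (p : nat) (H : {group gT}) (alpha : gT).
Hypothesis act_k : forall g c, c \in k -> act g c = c.
Hypothesis p_pr : prime p.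
Variable I : finType.
Implicit Types (w : I -> nat -> F).

(** For each i, the exponents of monomials in the [w i j] form a quotient of Z[X] / (1 + X + ... +
    X^(p-1)), that is of Z[zeta_p], with alpha acting as X. *)
Definition cyclic_eigenfamily w :=
  [/\ forall i j, act alpha (w i j) = w i j.+1,
      forall i, \prod_(j < p) w i j = 1
    & forall i j h, h \in H -> exists2 c, c \in k & act h (w i j) = c * w i j].

(** Only j < p - 1 is listed, the product relation giving the rest ([mem_family]): the number of
    generators must be sharp for the later counts. *)
Definition family_field w :=
  adjoin k (codom (fun ij : I * 'I_p.-1 => w ij.1 ij.2)).

HB.instance Definition _ w := GRing.DivringClosed.on (family_field w).

Section Family.
Variable w : I -> nat -> F.
Hypothesis w_good : cyclic_eigenfamily w.

Lemma family_alphaX i j m : act (alpha ^+ j)%g (w i m) = w i (m + j).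
Proof.
have [wa _ _] := w_good.
elim: j => [|j IHj]; first by rewrite expg0 act1 addn0.
by rewrite expgS actM IHj wa addnS.
Qed.

Lemma family_prod_shift i j : \prod_(l < p) w i (l + j) = 1.
Proof.
have [_ w1 _] := w_good; transitivity (act (alpha ^+ j)%g (\prod_(l < p) w i l)).
  by rewrite rmorph_prod; apply: eq_bigr => l _; rewrite family_alphaX.
by rewrite w1 rmorph1.
Qed.

Lemma family_neq0 i j : w i j != 0.
Proof.
have := family_prod_shift i j; have p0 := prime_gt0 p_pr.
rewrite (bigD1 (Ordinal p0)) //= add0n => /eqP; apply: contraTneq => ->.
by rewrite mul0r eq_sym oner_neq0.
Qed.

Lemma family_periodic i j : w i (j + p) = w i j.
Proof.
have := family_prod_shift i j; rewrite -[RHS](family_prod_shift i j.+1).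
have -> : p = p.-1.+1 by rewrite prednK ?prime_gt0.
rewrite big_ord_recl big_ord_recr /= add0n mulrC.
under eq_bigr do rewrite /bump add1n addSnnS.
move/mulfI => ->; first by rewrite addnC addSnnS.
by apply/prodf_neq0 => l _; apply: family_neq0.
Qed.

Lemma mem_family i j : w i j \in family_field w.
Proof.
have small l : (l < p.-1)%N -> w i l \in family_field w.
  move=> ltl; apply: mem_adjoin.
  by apply/codomP; exists (i, Ordinal ltl).
elim/ltn_ind: j => j IHj; have [ltj|] := ltnP j p.-1; first exact: small.
rewrite leq_eqVlt => /orP[/eqP <-|].
  have : \prod_(l < p.-1.+1) w i l = 1.
    by rewrite prednK ?prime_gt0 //; have [_ ->] := w_good.
  rewrite big_ord_recr /= => w1.
  set P := \prod_(i0 < _) _ in w1.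
  have P0 : P != 0 by apply/prodf_neq0 => l _; apply: family_neq0.
  have -> : w i p.-1 = P^-1 by apply: (mulfI P0); rewrite w1 mulfV.
  by rewrite rpredV; apply: rpred_prod => l _; apply: small.
rewrite prednK ?prime_gt0 // => lepj; rewrite -(subnK lepj) family_periodic.
by apply: IHj; rewrite ltn_subrL prime_gt0 ?(leq_trans (prime_gt0 p_pr)).
Qed.

End Family.

Lemma family_field_min w (M : divringClosed F) : {subset k <= M} -> (forall i j, w i j \in M) ->
  {subset family_field w <= M}.
Proof. by move=> kM wM; apply: adjoin_min => // _ /codomP[ij ->]. Qed.

Lemma fixed_adjoin g (L : divringClosed F) (xs : seq F) : (forall z, z \in L -> act g z = z) ->
  (forall z, z \in xs -> act g z = z) -> forall z, z \in adjoin L xs -> act g z = z.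
Proof.
move=> fL fxs z zin; pose M : {pred F} := fun z => act g z == z.
have Mdr : divring_closed M.
  split=> [|u v /eqP uM /eqP vM|u v /eqP uM /eqP vM]; rewrite unfold_in; apply/eqP.
  - exact: rmorph1.
  - by rewrite rmorphB uM vM.
  - by rewrite fmorph_div uM vM.
pose Mi := GRing.isDivringClosed.Build F M Mdr.
pose M' : divringClosed F := HB.pack M Mi.
apply/eqP; have: z \in M'; last by [].
by apply: adjoin_min zin => y yin; apply/eqP; [apply: fL | apply: fxs].
Qed.

(** * Invariants of a Kummer extension of degree p *)

Section Kummer.
Variables (L : divringClosed F) (d : gT) (lam v : F).
Hypothesis L_fixed : forall z, z \in L -> act d z = z.
Hypothesis kL : {subset k <= L}.
Hypothesis lam_k : lam \in k.
Hypothesis lam_prim : p.-primitive_root lam.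
Hypothesis act_v : act d v = lam * v.
Hypothesis vpL : v ^+ p \in L.

Lemma kummer_act l (P : {poly F}) : P \is a polyOver L ->
  act (d ^+ l)%g P.[v] = P.[lam ^+ l * v].
Proof.
move=> /polyOverP PL; have fixL z : z \in L -> act (d ^+ l)%g z = z.
  move=> zL; elim: l => [|l IHl]; first by rewrite expg0 act1.
  by rewrite expgS actM IHl L_fixed.
have fixv : act (d ^+ l)%g v = lam ^+ l * v.
  elim: l {fixL} => [|l IHl]; first by rewrite expg0 act1 mul1r.
  by rewrite expgS actM IHl rmorphM rmorphXn act_v /= act_k // mulrA exprSr.
rewrite !horner_coef rmorph_sum; apply: eq_bigr => i _.
by rewrite rmorphM rmorphXn /= fixL // fixv.
Qed.

(* Averaging over the powers of d kills the terms of degree prime to p.       *)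
Lemma kummer_average (P : {poly F}) : P \is a polyOver L -> act d P.[v] = P.[v] -> P.[v] \in L.
Proof.
move=> PL fixP; have p0 : p%:R != 0 :> F := prim_root_natf_neq0 lam_prim.
have pL : p%:R \in L by apply: rpred_nat.
have fixPl l : act (d ^+ l)%g P.[v] = P.[v].
  by elim: l => [|l IHl]; rewrite ?expg0 ?act1 // expgS actM IHl.
suff: P.[v] *+ p \in L.
  by rewrite -mulr_natr => PpL; rewrite -(mulfK p0 P.[v]) rpred_div.
have <- : \sum_(l < p) act (d ^+ l)%g P.[v] = P.[v] *+ p.
  by under eq_bigr do rewrite fixPl; rewrite sumr_const card_ord.
under eq_bigr do rewrite kummer_act // horner_coef.
rewrite exchange_big; apply: rpred_sum => i _ /=.
under eq_bigr do rewrite exprMn -exprM mulnC exprM mulrCA.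
rewrite -mulr_suml; have [pi|pi] := boolP (p %| i)%N.
  rewrite rpredM ?rpredM ?(polyOverP PL) //.
    by apply: rpred_sum => l _; rewrite !rpredX // kL.
  by have /dvdnP[m ->] := pi; rewrite mulnC exprM rpredX.
have li1 : lam ^+ i - 1 != 0.
  by rewrite subr_eq0 -(prim_order_dvd lam_prim).
suff -> : \sum_(l < p) (lam ^+ i) ^+ l = 0 by rewrite mul0r rpred0.
apply: (mulfI li1); rewrite -subrX1 -exprM mulnC exprM.
by rewrite (prim_expr_order lam_prim) expr1n subrr mulr0.
Qed.

Lemma kummer_invariants z : z \in adjoin L [:: v] -> act d z = z -> z \in L.
Proof.
move=> zv fixz.
have fixzl l : act (d ^+ l)%g z = z.
  by elim: l => [|l IHl]; rewrite ?expg0 ?act1 // expgS actM IHl.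
have [||P [Q [PL QL Q0 -> fixPQ]]] :=
    @invariant_fraction _ _ act act1 actM [group of <[d]>%g] L v z _ zv.
- move=> _ P /cycleP[l ->] PL; rewrite kummer_act //.
  exists (P \Po (lam ^+ l *: 'X)); last by rewrite horner_comp !hornerE.
  by rewrite polyOver_comp // polyOverZ ?polyOverX // rpredX ?kL.
- by move=> _ /cycleP[l ->].
have [fixP fixQ] := fixPQ d (cycle_id d).
by rewrite rpred_div // kummer_average.
Qed.

End Kummer.

(** [d] scales row i by a p-th root of unity lam_i. If some lam_i0 is not 1, the monomials with
    trivial character form a sublattice of index p: multiply row i0 by the prime zeta_p - 1 and
    correct the other rows by powers of row i0. The new family has the same shape, and the old field
    is obtained from the new one by adjoining a single v with v^p in it, so Kummer theory identifies
    the invariants. *)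
Lemma family_step w (D : {group gT}) d : cyclic_eigenfamily w ->
  (forall z g, z \in family_field w -> g \in D -> act g z = z) ->
  d \in H -> (d ^+ p)%g \in D -> (forall g, [~ d, g]%g \in D) ->
  exists w', cyclic_eigenfamily w' /\
    forall z, z \in family_field w' <-> z \in family_field w /\ act d z = z.
Proof.
move=> wg fixD dH dpD dD; have [wa w1 wH] := wg.
have memw := mem_family wg; have w0 := family_neq0 wg.
have kw : {subset k <= family_field w} by apply: sub_adjoin.
have p0 := prime_gt0 p_pr.
have /choice[lam lamP] i : exists c, c \in k /\ act d (w i 0%N) = c * w i 0%N.
  by have [c ck cw] := wH i 0%N d dH; exists c.
(* The eigenvalue does not depend on j, because [d] and alpha commute up to an element of [D], which
   acts trivially. *)
have lam_w i j : act d (w i j) = lam i * w i j.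
  elim: j => [|j IHj]; first by have [] := lamP i.
  rewrite -wa -actM commgC actM (fixD _ _ (memw _ _) (dD _)) actM IHj.
  by rewrite rmorphM act_k //; have [] := lamP i.
have lam_p i : lam i ^+ p = 1.
  have [lk _] := lamP i.
  have powl l : act (d ^+ l)%g (w i 0%N) = lam i ^+ l * w i 0%N.
    elim: l => [|l IHl]; first by rewrite expg0 act1 mul1r.
    by rewrite expgS actM IHl rmorphM rmorphXn /= act_k // lam_w mulrA exprSr.
  apply: (mulIf (w0 i 0%N)); rewrite mul1r -powl; exact: fixD.
have lam_neq0 i : lam i != 0.
  apply: contra_eq_neq (lam_p i) => ->.
  by rewrite expr0n eqn0Ngt p0 eq_sym oner_neq0.
have [lam1|] := EM (forall i, lam i = 1).
  exists w; split=> // z; split=> [zw|[]//]; split=> //.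
  apply: fixed_adjoin zw => [c ck|_ /codomP[ij ->]]; first exact: act_k.
  by rewrite lam_w lam1 mul1r.
move=> /existsNP[i0 /eqP lam_i0].
have lam_prim : p.-primitive_root (lam i0).
  have [m m_prim] := prim_order_exists p0 (lam_p i0).
  have [_ p_div] := primeP p_pr; move=> /p_div/orP[] /eqP m_eq; last by rewrite -m_eq.
  by move: (prim_expr_order m_prim) lam_i0; rewrite m_eq expr1 => ->; rewrite eqxx.
have /choice[a aP] i : exists m, lam i = lam i0 ^+ m.
  by have [m ->] := prim_rootP lam_prim (lam_p i); exists m.
pose w' i j := if i == i0 then w i0 j.+1 / w i0 j else w i j / w i0 j ^+ a i.
have w'i0 j : w' i0 j = w i0 j.+1 / w i0 j by rewrite /w' eqxx.
have w'_mem i j : w' i j \in family_field w.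
  by rewrite /w'; case: eqP => _; rewrite rpred_div ?rpredX.
have dw' i j : act d (w' i j) = w' i j.
  rewrite /w'; case: eqP => _; rewrite fmorph_div ?rmorphXn /= !lam_w.
    by rewrite -mulf_div divff ?mul1r.
  by rewrite exprMn -mulf_div -aP divff ?mul1r.
pose v := w i0 0%N; pose P j := \prod_(l < j) w' i0 l.
have wvP j : w i0 j = v * P j.
  elim: j => [|j IHj]; first by rewrite /P big_ord0 mulr1.
  by rewrite /P big_ord_recr /= -/(P j) mulrA -IHj w'i0 mulrC divfK.
have w'g : cyclic_eigenfamily w'.
  split=> [i j|i|i j h hH].
  - rewrite /w'; case: eqP => _; rewrite fmorph_div ?rmorphXn /= !wa //.
  - have [->|ii0] := eqVneq i i0.
      have := wvP p; rewrite -{1}[p]add0n (family_periodic wg) -/v => vP.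
      by apply: (mulfI (w0 i0 0%N)); rewrite mulr1 -/v -/(P p) -vP.
    rewrite /w' (negPf ii0) prodf_div prodrXl !w1 expr1n invr1 mulr1 //.
  have [c0 c0k hc0] := wH i0 j h hH; have [c1 c1k hc1] := wH i0 j.+1 h hH.
  have [c ck hc] := wH i j h hH.
  rewrite /w'; case: eqP => _; rewrite fmorph_div ?rmorphXn /=.
    by exists (c1 / c0); rewrite ?rpred_div // hc0 hc1 mulf_div.
  exists (c / c0 ^+ a i); rewrite ?rpred_div ?rpredX //.
  by rewrite hc hc0 exprMn mulf_div.
exists w'; split=> // z; have memw' := mem_family w'g.
have L_fixed y : y \in family_field w' -> act d y = y.
  by apply: fixed_adjoin => [c ck|_ /codomP[ij ->]]; [apply: act_k | apply: dw'].
split=> [zw'|[zw dz]].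
  by split; [apply: family_field_min zw' | apply: L_fixed].
have P_mem j : P j \in family_field w' by apply: rpred_prod.
apply: (kummer_invariants L_fixed _ _ lam_prim (lam_w i0 0%N)) dz.
- exact: sub_adjoin.
- by have [] := lamP i0.
(* Substituting w i0 j = v P_j into the product relation of row i0 expresses v^p through the new
   family. *)
- have : v ^+ p * \prod_(j < p) P j = 1.
    rewrite -[RHS](w1 i0) -[X in v ^+ X](card_ord p) -prodr_const -big_split.
    by apply: eq_bigr => j _; rewrite wvP.
  move=> vP1; have PP0 : \prod_(j < p) P j != 0.
    by apply: contra_eq_neq vP1 => ->; rewrite mulr0 eq_sym oner_neq0.
  rewrite -/v (_ : v ^+ p = (\prod_(j < p) P j)^-1); first by rewrite rpredV rpred_prod.
  by apply: (mulIf PP0); rewrite vP1 mulVf.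
have vin : v \in adjoin (family_field w') [:: v] by apply: mem_adjoin; rewrite inE.
have L_in y : y \in family_field w' -> y \in adjoin (family_field w') [:: v].
  exact: sub_adjoin.
have wi0 j : w i0 j \in adjoin (family_field w') [:: v].
  by rewrite wvP rpredM // L_in.
apply: family_field_min zw => [c ck|i j]; first by apply/L_in/sub_adjoin.
have [->//|ii0] := eqVneq i i0.
have -> : w i j = w' i j * w i0 j ^+ a i.
  by rewrite /w' (negPf ii0) divfK // expf_neq0.
by rewrite rpredM ?rpredX // L_in.
Qed.

(** Induction on the order of D along [central_step]; the field for [D0] is fixed by [D0], which is
    what [family_step] requires. *)
Lemma family_invariants w (D : {group gT}) : (p.-group [set: gT])%g ->
  (D <| [set: gT])%g -> D \subset H -> cyclic_eigenfamily w ->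
  exists w', cyclic_eigenfamily w' /\ forall z, z \in family_field w' <->
    z \in family_field w /\ forall g, g \in D -> act g z = z.
Proof.
move=> pG; have [n] := ubnP #|D|; elim: n => // n IHn in D *.
rewrite ltnS => leDn nDG sDH wg; have [D1|ntD] := eqVneq (D : {set gT}) 1%g.
  exists w; split=> // z; split=> [zw|[]//]; split=> // g.
  by rewrite D1 => /set1P->; rewrite act1.
have [D0 [d [nD0G prD0 dD dpD0 [dD0 DD0d]]]] := central_step pG nDG ntD.
have [||w0 [w0g w0E]] := IHn D0 _ nD0G _ wg.
- exact: leq_trans (proper_card prD0) leDn.
- exact: subset_trans (proper_sub prD0) sDH.
have [|w' [w'g w'E]] := family_step w0g _ (subsetP sDH d dD) dpD0 dD0.
  by move=> z g /w0E[_]; apply.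
exists w'; split=> // z; split=> [/w'E[/w0E[zw fixD0] fixd]|[zw fixD]].
  split=> // g gD; pose S := [set g | act g z == z].
  have S_group : group_set S.
    apply/group_setP; split=> [|g1 g2]; first by rewrite inE act1.
    by rewrite !inE actM => /eqP g1z /eqP->; rewrite g1z.
  have: g \in Group S_group.
    apply: subsetP gD; apply: subset_trans DD0d _.
    rewrite join_subG cycle_subG inE fixd eqxx andbT.
    by apply/subsetP => h hD0; rewrite inE fixD0.
  by rewrite inE => /eqP.
apply/w'E; split; last exact: fixD.
by apply/w0E; split=> // g gD0; apply/fixD/(subsetP (proper_sub prD0)).
Qed.

Lemma sum_shift (f : nat -> F) n : f n = f 0%N ->
  \sum_(j < n) f j.+1 = \sum_(j < n) f j.
Proof.
move=> fn; apply/eqP; rewrite -subr_eq0 -sumrB.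
by rewrite -(big_mkord xpredT (fun j => f j.+1 - f j)) telescope_sumr // fn subrr.
Qed.

(** * Linearising the cyclic action of alpha *)

Section Linearize.
Variables (w : I -> nat -> F) (zeta : F).
Hypothesis w_good : cyclic_eigenfamily w.
Hypothesis zeta_k : zeta \in k.
Hypothesis zeta_prim : p.-primitive_root zeta.

Definition partial_prod i j := \prod_(l < j) w i l.
Definition prod_sum i := \sum_(j < p) partial_prod i j.
Hypothesis prod_sum_neq0 : forall i, prod_sum i != 0.

(** alpha sends both U_j to U_(j+1) / w_0 and the sum to itself over w_0, so the factor w_0 cancels
    and alpha permutes the quotients cyclically. They sum to 1 and recover w_j as T_(j+1) / T_j. *)
Definition simplex_coord i j := partial_prod i j / prod_sum i.
Definition fourier_coord i m := \sum_(j < p) zeta ^+ (j * m) * simplex_coord i j.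

Local Notation U := partial_prod.
Local Notation T := simplex_coord.
Local Notation s := fourier_coord.

Lemma partial_prodS i j : U i j.+1 = U i j * w i j.
Proof. by rewrite /U big_ord_recr. Qed.

Lemma partial_prod_neq0 i j : U i j != 0.
Proof. by apply/prodf_neq0 => l _; apply: family_neq0. Qed.

Lemma partial_prod0 i : U i 0 = 1. Proof. by rewrite /U big_ord0. Qed.

Lemma partial_prod_p i : U i p = 1. Proof. by rewrite /U; have [_ ->] := w_good. Qed.

Lemma act_partial_prod i j : act alpha (U i j) = U i j.+1 / w i 0%N.
Proof.
have [wa _ _] := w_good; apply: (mulIf (family_neq0 w_good i 0)).
rewrite divfK ?family_neq0 // rmorph_prod /U big_ord_recl mulrC; congr (_ * _).
by apply: eq_bigr => l _; rewrite wa.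
Qed.

Lemma act_prod_sum i : act alpha (prod_sum i) = prod_sum i / w i 0%N.
Proof.
rewrite rmorph_sum /prod_sum -(sum_shift (f := U i)) ?partial_prod_p ?partial_prod0 //.
by rewrite mulr_suml; apply: eq_bigr => j _; rewrite act_partial_prod.
Qed.

Lemma act_simplex_coord i j : act alpha (T i j) = T i j.+1.
Proof.
rewrite fmorph_div act_partial_prod act_prod_sum invf_div mulrA divfK //.
exact: family_neq0.
Qed.

Lemma act_fourier_coord i m : act alpha (s i m) = zeta ^- m * s i m.
Proof.
have z0 : zeta != 0.
  apply: contra_eq_neq (prim_expr_order zeta_prim) => ->.
  by rewrite expr0n eqn0Ngt prime_gt0 // eq_sym oner_neq0.
apply: (mulfI (expf_neq0 m z0)); rewrite mulVKf ?expf_neq0 //.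
transitivity (\sum_(j < p) zeta ^+ (j.+1 * m) * T i j.+1).
  rewrite rmorph_sum mulr_sumr; apply: eq_bigr => j _.
  by rewrite rmorphM rmorphXn /= act_k // act_simplex_coord mulrA -exprD mulSn.
apply: (sum_shift (f := fun j => zeta ^+ (j * m) * T i j)).
by rewrite exprM (prim_expr_order zeta_prim) expr1n /T partial_prod_p partial_prod0.
Qed.

Lemma fourier_coord0 i : s i 0%N = 1.
Proof.
rewrite /s; under eq_bigr do rewrite muln0 expr0 mul1r.
by rewrite -mulr_suml; apply: divff (prod_sum_neq0 i).
Qed.

(** Orthogonality of characters is needed only at j = 0; applying alpha to the identity for j gives
    the one for j + 1. *)
Lemma fourier_inversion i j :
  p%:R * T i j = \sum_(m < p) (zeta ^- m) ^+ j * s i m.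
Proof.
elim: j => [|j IHj].
  under [RHS]eq_bigr do rewrite mul1r.
  rewrite exchange_big /= (bigD1 (Ordinal (prime_gt0 p_pr))) //= [X in _ + X]big1.
    under eq_bigr do rewrite mul0n mul1r.
    by rewrite sumr_const card_ord addr0 mulr_natl.
  move=> l l0; under eq_bigr do rewrite exprM.
  rewrite -mulr_suml; set z := zeta ^+ l; apply/eqP; rewrite mulf_eq0; apply/orP; left.
  have z1 : z - 1 != 0.
    rewrite subr_eq0 -(prim_order_dvd zeta_prim) gtnNdvd // lt0n.
    by apply: contra l0 => /eqP l0; apply/eqP/val_inj.
  rewrite -(inj_eq (mulfI z1)) -subrX1 mulr0 -exprM mulnC exprM.
  by rewrite (prim_expr_order zeta_prim) expr1n subrr.
rewrite -act_simplex_coord -[p%:R](rmorph_nat (act alpha)) -rmorphM IHj rmorph_sum.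
apply: eq_bigr => m _; rewrite rmorphM act_fourier_coord mulrA exprSr.
by rewrite act_k // rpredX // rpredV rpredX.
Qed.

Definition fourier_coords : seq F :=
  codom (fun im : I * 'I_p.-1 => s im.1 im.2.+1).

Lemma fourier_field : adjoin k fourier_coords =i family_field w.
Proof.
have kw : {subset k <= family_field w} by apply: sub_adjoin.
have wm := mem_family w_good.
have Uw i j : U i j \in family_field w by apply: rpred_prod.
have sw i m : s i m \in family_field w.
  apply: rpred_sum => j _; apply: rpredM; first by rewrite rpredX ?kw.
  by apply: rpred_div => //; apply: rpred_sum.
have ks : {subset k <= adjoin k fourier_coords} by apply: sub_adjoin.
have ss i m : (m < p)%N -> s i m \in adjoin k fourier_coords.
  case: m => [|m] mp; first by rewrite fourier_coord0 rpred1.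
  apply: mem_adjoin; have mp' : (m < p.-1)%N by rewrite -ltnS prednK ?prime_gt0.
  by apply/codomP; exists (i, Ordinal mp').
have Ts i j : T i j \in adjoin k fourier_coords.
  rewrite -[T i j](mulKf (prim_root_natf_neq0 zeta_prim)) fourier_inversion.
  rewrite rpredM ?rpredV ?rpred_nat //; apply: rpred_sum => m _.
  by rewrite rpredM ?ss // rpredX // rpredV rpredX ?ks.
move=> z; apply/idP/idP; first by apply: adjoin_min => // _ /codomP[im ->].
apply: family_field_min => // i j.
have -> : w i j = T i j.+1 / T i j.
  rewrite /T partial_prodS invf_div mulrA divfK // mulrAC divff ?mul1r //.
  exact: partial_prod_neq0.
exact: rpred_div.
Qed.

End Linearize.

End Monomial.

(** * Monomial actions *)

Section MonomialAction.
Variables (F : fieldType) (gT : finGroupType) (act : gT -> {rmorphism F -> F}).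
Hypothesis act1 : forall x, act 1%g x = x.
Hypothesis actM : forall g h x, act (g * h)%g x = act g (act h x).
Variables (k : divringClosed F) (p : nat) (H : {group gT}) (alpha : gT).
Hypothesis act_k : forall g c, c \in k -> act g c = c.
Hypothesis p_pr : prime p.
Hypothesis pG : (p.-group [set: gT])%g.
Hypothesis nHG : (H <| [set: gT])%g.
Hypothesis alphaP : forall g, exists j h, h \in H /\ g = (alpha ^+ j * h)%g.
Variables (I : finType) (u c : I -> F) (zeta : F) (xs : seq F).
Hypothesis u_eigen : forall i h, h \in H -> exists2 a, a \in k & act h (u i) = a * u i.
Hypothesis c_k : forall i, c i \in k.
Hypothesis c_p : forall i, act (alpha ^+ p)%g (u i) = c i ^+ p * u i.
Hypothesis zeta_k : zeta \in k.
Hypothesis zeta_prim : p.-primitive_root zeta.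
Hypothesis tower_xs : tower k xs.
Hypothesis size_xs : size xs = (#|I| * p)%N.

Local Notation X i j := (act (alpha ^+ j)%g (u i)).
Hypothesis generated : forall z,
  z \in adjoin k (codom (fun ij : I * 'I_p => X ij.1 ij.2)).

Lemma tower_neq0 (L : divringClosed F) ys y : tower L ys -> y \in ys -> y != 0.
Proof.
elim: ys L => //= x ys IHys L [xL tys]; rewrite inE => /orP[/eqP->|].
  by apply: contraNneq xL => ->; rewrite rpred0.
exact: IHys tys.
Qed.

(** The p |I| translates generate F, whose transcendence degree is p |I|; hence they are
    independent, in particular nonzero. *)
Lemma eigenvector_neq0 i : u i != 0.
Proof.
have tX : tower k (codom (fun ij : I * 'I_p => X ij.1 ij.2)).
  apply: tower_of_size tower_xs _ _; last by rewrite size_codom card_prod card_ord size_xs.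
  by move=> z _; apply: sub_algcl.
apply: (tower_neq0 tX); apply/codomP; exists (i, Ordinal (prime_gt0 p_pr)).
by rewrite /= expg0 act1.
Qed.

Lemma orbit_neq0 i j : X i j != 0.
Proof. by rewrite fmorph_eq0 eigenvector_neq0. Qed.

Lemma scalar_neq0 i : c i != 0.
Proof.
apply: contraNneq (orbit_neq0 i p) => c0.
by rewrite c_p c0 expr0n eqn0Ngt prime_gt0 // mul0r.
Qed.

(** Dividing by [c i], a p-th root of the eigenvalue of alpha^p, makes the product over a full cycle
    telescope to 1. *)
Definition ratio i j := X i j.+1 / (c i * X i j).
Local Notation Y := ratio.

Lemma orbitS i j : X i j.+1 = c i * Y i j * X i j.
Proof.
by rewrite mulrAC [RHS]mulrC divfK // mulf_neq0 ?scalar_neq0 ?orbit_neq0.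
Qed.

Lemma act_orbit i j h : h \in H -> exists2 a, a \in k & act h (X i j) = a * X i j.
Proof.
move=> hH; have hH' : (h ^ (alpha ^+ j) \in H)%g.
  by rewrite memJ_norm // (subsetP (normal_norm nHG)) ?inE.
have [a ak ha] := u_eigen i hH'; exists a => //.
by rewrite -actM conjgC actM ha rmorphM act_k.
Qed.

Lemma ratio_good : cyclic_eigenfamily act k p H alpha Y.
Proof.
split=> [i j|i|i j h hH].
- by rewrite fmorph_div rmorphM (act_k _ (c_k i)) -!actM -!expgS.
- have telescope n : c i ^+ n * u i * \prod_(j < n) Y i j = X i n.
    elim: n => [|n IHn]; first by rewrite big_ord0 expg0 act1 mul1r mulr1.
    rewrite big_ord_recr orbitS -IHn exprS /=; move: (ratio i n) => y.
    by rewrite [RHS]mulrAC !mulrA.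
  have cu0 : c i ^+ p * u i != 0.
    by rewrite mulf_neq0 ?expf_neq0 ?scalar_neq0 ?eigenvector_neq0.
  by apply: (mulfI cu0); rewrite telescope c_p mulr1.
have [a ak ha] := act_orbit i j hH; have [b bk hb] := act_orbit i j.+1 hH.
exists (b / a); first exact: rpred_div.
by rewrite fmorph_div rmorphM (act_k _ (c_k i)) ha hb [c i * (a * _)]mulrCA -mulf_div.
Qed.

Lemma generated_min (M : divringClosed F) : {subset k <= M} ->
  (forall i j, Y i j \in M) -> (forall i, u i \in M) -> forall z, z \in M.
Proof.
move=> kM YM uM z; have XM i j : X i j \in M.
  elim: j => [|j IHj]; first by rewrite expg0 act1.
  rewrite orbitS; apply: rpredM => //; apply: rpredM; [exact: kM | exact: YM].
by apply: adjoin_min (generated z) => // _ /codomP[ij ->].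
Qed.

Lemma orbit_ratio i j : exists2 a, a \in family_field k p Y & X i j = a * u i.
Proof.
elim: j => [|j [a aY Xa]]; first by exists 1; rewrite ?rpred1 ?expg0 ?act1 ?mul1r.
exists (c i * Y i j * a); last by rewrite orbitS Xa mulrA.
apply: rpredM => //; apply: rpredM; first exact: sub_adjoin.
exact: (mem_family act1 actM p_pr ratio_good).
Qed.

Section Invariants.
Variable w : I -> nat -> F.
Hypothesis w_good : cyclic_eigenfamily act k p H alpha w.
Hypothesis w_inv : forall z, z \in family_field k p w <->
  z \in family_field k p Y /\ forall h, h \in H -> act h z = z.

Let memw := mem_family act1 actM p_pr w_good.

(* Y i j ^+ #|H| is H-invariant, since H acts on Y i j through a character.   *)
Lemma algebraic_over_invariants (M : divringClosed F) : {subset k <= M} ->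
  {subset family_field k p w <= M} -> (forall i, u i \in M) ->
  forall z, z \in algcl M.
Proof.
move=> kM wM uM; apply: generated_min => [z zk|i j|i].
- by apply/sub_algcl/kM.
- have [_ _ YH] := ratio_good; apply/algclP.
  exists ('X^#|H| - (Y i j ^+ #|H|)%:P); split.
  + rewrite rpredB ?rpredX ?polyOverX // polyOverC wM //; apply/w_inv.
    split; first by rewrite rpredX // (mem_family act1 actM p_pr ratio_good).
    move=> h hH; have [a ak ha] := YH i j h hH; rewrite rmorphXn /= ha exprMn.
    have powl l : act (h ^+ l)%g (Y i j) = a ^+ l * Y i j.
      elim: l => [|l IHl]; first by rewrite expg0 act1 mul1r.
      by rewrite expgS actM IHl rmorphM rmorphXn /= act_k // ha mulrA exprSr.
    suff -> : a ^+ #|H| = 1 by rewrite mul1r.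
    have Y0 := family_neq0 act1 actM p_pr ratio_good i j.
    by apply: (mulIf Y0); rewrite -powl expg_cardG // act1 mul1r.
  + by rewrite -size_poly_gt0 size_XnsubC ?cardG_gt0.
  + by rewrite rootE !hornerE ?hornerXn subrr ?eqxx.
- by apply/sub_algcl/uM.
Qed.

(** If the sum vanished, one of the generators [w] would lie in the field of the others, and F would
    be algebraic over a field with p |I| - 1 generators, against [steinitz]. *)
Lemma prod_sum_neq0 i0 : prod_sum p w i0 != 0.
Proof.
apply/negP => /eqP S0.
have [q def_p] : exists q, p = q.+2 by case: p p_pr => [|[|q]] // _; exists q.
have ltq : (q < p.-1)%N by rewrite def_p.
pose ij0 : I * 'I_p.-1 := (i0, Ordinal ltq).
pose ws := map (fun ij : I * 'I_p.-1 => w ij.1 ij.2) (rem ij0 (enum {: I * 'I_p.-1})).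
pose M := adjoin k (ws ++ codom u).
have kM : {subset k <= M} by apply: sub_adjoin.
have uM i : u i \in M by apply: mem_adjoin; rewrite mem_cat codom_f orbT.
have wM (ij : I * 'I_p.-1) : ij != ij0 -> w ij.1 ij.2 \in M.
  move=> ijn; apply: mem_adjoin; rewrite mem_cat map_f //.
  by rewrite (rem_filter _ (enum_uniq _)) mem_filter /= ijn mem_enum.
have w_lt j : (j < q)%N -> w i0 j \in M.
  move=> ltj; have ltj' : (j < p.-1)%N by rewrite def_p ltnS ltnW.
  apply: (wM (i0, Ordinal ltj')); apply: contraTneq ltj => -[->].
  by rewrite ltnn.
have U_le j : (j <= q)%N -> partial_prod w i0 j \in M.
  move=> lej; apply: rpred_prod => l _; apply: w_lt; exact: leq_trans (ltn_ord l) lej.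
have wq : w i0 q \in M.
  have U0 : partial_prod w i0 q != 0 := partial_prod_neq0 act1 actM p_pr w_good i0 q.
  (* With q = p - 2, the last summand is U_(p-1) = U_q w_q, the only one involving w_q, so the
     vanishing sum can be solved for w_q. *)
  have -> : w i0 q = - (\sum_(j < q.+1) partial_prod w i0 j) / partial_prod w i0 q.
    apply: (mulIf U0); rewrite divfK // mulrC -partial_prodS.
    apply/eqP; rewrite -addr_eq0 addrC; apply/eqP.
    by move: S0; rewrite /prod_sum def_p big_ord_recr.
  rewrite rpred_div ?rpredN ?U_le //; apply: rpred_sum => j _.
  by apply: U_le; rewrite -ltnS.
have : (size xs <= size (ws ++ codom u))%N.
  apply: (steinitz tower_xs) => x _; apply: algebraic_over_invariants => // z.
  apply: adjoin_min => // _ /codomP[ij ->]; have [->//|] := eqVneq ij ij0.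
  exact: wM.
apply/negP; rewrite -ltnNge size_xs size_cat size_map size_codom size_rem ?mem_enum //.
rewrite -cardE card_prod card_ord def_p /= (mulnSr _ q.+1).
rewrite ltn_add2r ltn_predL muln_gt0 andbT.
by apply/card_gt0P; exists i0.
Qed.

Lemma affine_tower_of (L : divringClosed F) ys :
  (forall y g, y \in ys -> exists a b, [/\ a \in L, b \in L & act g y = a * y + b]) ->
  affine_tower act L ys.
Proof.
elim: ys L => //= y ys IHys L ysL; split=> [g|]; first by apply: ysL; rewrite inE eqxx.
apply: IHys => z g zys; have [|a [b [aL bL ->]]] := ysL z g.
  by rewrite inE zys orbT.
by exists a, b; rewrite !(@sub_adjoin _ L).
Qed.

Local Notation ss := (fourier_coords p w zeta).

Let ssE : adjoin k ss =i family_field k p w :=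
  fourier_field act1 actM act_k p_pr w_good zeta_k zeta_prim prod_sum_neq0.

(** By counting: together with the u_i these are |I| (p - 1) + |I| elements over which F is
    algebraic. *)
Lemma fourier_coords_tower : tower k ss.
Proof.
suff /tower_cat[] : tower k (ss ++ codom u) by [].
apply: tower_of_size tower_xs _ _.
  move=> x _; apply: algebraic_over_invariants => [|z|i].
  - exact: sub_adjoin.
  - by rewrite -ssE; apply: adjoin_sub => // y; rewrite mem_cat => ->.
  - by apply: mem_adjoin; rewrite mem_cat codom_f orbT.
rewrite size_cat !size_codom card_prod card_ord size_xs.
by rewrite -mulnSr prednK ?prime_gt0.
Qed.

Lemma eigenvectors_tower : tower (family_field k p Y) (codom u).
Proof.
pose ys := codom (fun ij : I * 'I_p.-1 => Y ij.1 ij.2).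
suff /tower_cat[_] : tower k (ys ++ codom u) by [].
apply: tower_of_size tower_xs _ _.
  move=> x _; apply: sub_algcl; apply: generated_min x => [|i j|i].
  - exact: sub_adjoin.
  - have : Y i j \in family_field k p Y by apply: mem_family ratio_good _ _.
    by apply: adjoin_sub => // y; rewrite mem_cat => ->.
  - by apply: mem_adjoin; rewrite mem_cat codom_f orbT.
rewrite size_cat !size_codom card_prod card_ord size_xs.
by rewrite -mulnSr prednK ?prime_gt0.
Qed.

Lemma invariants_k : invariants act k =i k.
Proof.
move=> z; apply/idP/idP => [/invariantsP[]//|zk].
by apply/invariantsP; split=> // g; apply: act_k.
Qed.

Lemma act_stable_ratio_field : act_stable act (family_field k p Y).
Proof.
apply: act_stable_adjoin => [g z zk|g _ /codomP[[i j] ->]]; first by rewrite act_k.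
have [l [h [hH ->]]] := alphaP g; have [_ _ YH] := ratio_good.
have [a ak ha] := YH i j h hH.
rewrite /= actM ha rmorphM act_k // (family_alphaX act1 actM ratio_good).
by rewrite rpredM ?(mem_family act1 actM p_pr ratio_good) // sub_adjoin.
Qed.

Lemma ratio_invariants :
  invariants act (family_field k p Y) =i invariants act (adjoin k ss).
Proof.
move=> z; apply/invariantsP/invariantsP => -[zY zf]; split=> //.
  by rewrite ssE; apply/w_inv; split=> // h _; apply: zf.
by move: zY; rewrite ssE => /w_inv[].
Qed.

(** Invariants of G in k(Y) lie in the H-invariants k(w) = k(s), where H is trivial and alpha scales
    each s by a root of unity: an affine tower over k. *)
Lemma fourier_invariants : exists2 fs, tower k fs &
  invariants act (family_field k p Y) =i adjoin k fs.
Proof.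
have [|||fs [_ tfs fsE]] := @affine_tower_invariants _ _ _ act1 actM k ss.
- by move=> g z zk; rewrite act_k.
- exact: fourier_coords_tower.
- apply: affine_tower_of => _ g /codomP[[i m] ->].
  have [l [h [hH ->]]] := alphaP g; set s := fourier_coord _ _ _ _ _.
  have hs : act h s = s.
    have : s \in family_field k p w.
      by rewrite -ssE; apply: mem_adjoin; apply: (codom_f _ (i, m)).
    by move=> /w_inv[_]; apply.
  exists ((zeta ^- m.+1) ^+ l), 0.
  rewrite rpred0 addr0 actM hs; split=> //; first by rewrite rpredX // rpredV rpredX.
  have zk : zeta ^- m.+1 \in k by rewrite rpredV rpredX.
  elim: l => [|l IHl]; first by rewrite expg0 act1 mul1r.
  rewrite expgS actM IHl rmorphM act_k ?rpredX //.
  rewrite (act_fourier_coord act1 actM act_k p_pr w_good zeta_k zeta_prim) mulrA.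
  by rewrite -(exprSr (zeta ^- m.+1)).
exists fs; first by apply: tower_sub tfs => z; rewrite invariants_k.
move=> z; rewrite ratio_invariants fsE.
exact: eq_adjoin invariants_k (frefl _) z.
Qed.

End Invariants.

(** F is k(Y) with the u_i adjoined, and g = alpha^l h multiplies u_i by an element of k(Y); the
    affine tower u over k(Y) therefore descends to k(Y)^G. *)
Lemma monomial_invariants : exists2 fs, tower k fs &
  forall z, z \in adjoin k fs <-> forall g, act g z = z.
Proof.
have [w [w_good w_inv]] :=
  family_invariants act1 actM act_k p_pr pG nHG (subxx H) ratio_good.
have [fs tfs fsE] := fourier_invariants w_good w_inv.
have [|||fs' [_ tfs' fsE']] :=
    @affine_tower_invariants _ _ _ act1 actM (family_field k p Y) (codom u).
- exact: act_stable_ratio_field.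
- exact: eigenvectors_tower.
- apply: affine_tower_of => _ g /codomP[i ->].
  have [l [h [hH ->]]] := alphaP g; have [a ak ha] := u_eigen i hH.
  have [b bY Xb] := orbit_ratio i l; exists (a * b), 0.
  rewrite rpred0 addr0 actM ha rmorphM act_k // Xb mulrA; split=> //.
  by rewrite rpredM // sub_adjoin.
have all_in z : z \in adjoin (family_field k p Y) (codom u).
  apply: generated_min z => [z zk|i j|i]; first by do 2!apply: sub_adjoin.
    by apply: sub_adjoin; apply: mem_family ratio_good _ _.
  by apply: mem_adjoin; apply: codom_f.
exists (fs ++ fs').
  by apply/tower_cat; split=> //; apply: tower_sub tfs' => z; rewrite fsE.
move=> z; rewrite adjoin_cat; rewrite -(eq_adjoin fsE (frefl _ : fs' =i fs')) -fsE'.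
by split=> [/invariantsP[]//|zf]; apply/invariantsP.
Qed.

End MonomialAction.

(** * Noether's field *)

Section NoetherAction.
Variables (K : fieldType) (gT : finGroupType).

Local Notation N := #|gT|.
Local Notation F := (ratfun K N).
Local Notation iota := (@ratfunC K N).
Local Notation x := (@noether_var K gT).

Definition noether_aut (g : gT) : {rmorphism F -> F} := @noether_act K gT g.

Lemma noether_aut_quotient g (a b : {mpoly K[N]}) : b != 0 ->
  noether_aut g (a%:F / b%:F) = (noether_subst g a)%:F / (noether_subst g b)%:F.
Proof. exact: frac_map_div (@noether_subst_inj K gT g) a b. Qed.

Lemma ratfun_quotient (z : F) : exists a b : {mpoly K[N]}, b != 0 /\ z = a%:F / b%:F.
Proof.
by exists (\n_(repr z)), (\d_(repr z)); rewrite denom_ratioP -frac_numden.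
Qed.

Lemma noether_aut1 z : noether_aut 1%g z = z.
Proof.
have [a [b [b0 ->]]] := ratfun_quotient z; rewrite noether_aut_quotient //.
have id1 (q : {mpoly K[N]}) : noether_subst 1%g q = q.
  apply: (mpoly_rmorph_ext (f := noether_subst 1%g) (g := idfun)) q => [c|i] /=.
    exact: comp_mpolyC.
  by rewrite -[in LHS](enum_valK i) noether_subst_var mul1g enum_valK.
by rewrite !id1.
Qed.

Lemma noether_autM g h z : noether_aut (g * h)%g z = noether_aut g (noether_aut h z).
Proof.
have [a [b [b0 ->]]] := ratfun_quotient z; rewrite !noether_aut_quotient //; last first.
  by rewrite (raddf_eq0 _ (@noether_subst_inj K gT h)).
have comp (q : {mpoly K[N]}) :
    noether_subst (g * h)%g q = noether_subst g (noether_subst h q).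
  apply: (mpoly_rmorph_ext (f := noether_subst (g * h)%g)
    (g := noether_subst g \o noether_subst h)) q => [c|i] /=.
    by rewrite /noether_subst !comp_mpolyC.
  by rewrite -(enum_valK i) !noether_subst_var mulgA.
by rewrite !comp.
Qed.

Lemma ev_noether_var (q : {mpoly K[N]}) : ev iota (codom x) q = q%:F.
Proof.
apply: (mpoly_rmorph_ext (f := ev iota (codom x)) (g := @FracField.tofrac _)) q => [c|i].
  by rewrite /= evC.
by rewrite /= evX (nth_codom 0) /noether_var enum_valK.
Qed.

Lemma noether_var_tower : tower (constants iota) (codom x).
Proof.
apply/(tower_constantsP _ (size_codom x)) => q /eqP.
by rewrite ev_noether_var tofrac_eq0 => /eqP.
Qed.

Lemma noether_var_generate z : z \in adjoin (constants iota) (codom x).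
Proof.
apply/(adjoin_constantsP _ _ (size_codom x)).
have [a [b [b0 ->]]] := ratfun_quotient z.
by exists a, b; rewrite !ev_noether_var tofrac_eq0.
Qed.

Lemma noether_rational (fs : seq F) : tower (constants iota) fs ->
  (forall z, z \in adjoin (constants iota) fs <-> forall g, noether_aut g z = z) ->
  rational_over (@noether_fieldC K gT).
Proof.
move=> tfs fsE; apply: (rational_of_tower (iota := iota)) tfs _ => // z.
by apply/noether_fixedP/idP => /fsE.
Qed.

Lemma noether_rational_pchar p : p \in [pchar K] -> (p.-group [set: gT])%g ->
  rational_over (@noether_fieldC K gT).
Proof.
move=> chp pG; have act_C g c : noether_aut g (iota c) = iota c.
  exact: noether_act_C.
have act_x g h : noether_aut g (x h) = x (g * h)%g by apply: noether_act_var.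
have [ys [sys ays xys]] := pgroup_affine_tower act_C act_x chp pG.
have all_in z : z \in adjoin (constants iota) ys.
  apply: adjoin_min (noether_var_generate z); first exact: sub_adjoin.
  by move=> y /codomP[h hy]; rewrite hy; apply: xys.
have tys : tower (constants iota) ys.
  apply: tower_of_size noether_var_tower _ _; last by rewrite size_codom sys.
  by move=> z _; apply: sub_algcl; apply: all_in.
have [fs [_ tfs fsE]] := affine_tower_invariants noether_aut1 noether_autM
  (act_stable_constants act_C) tys ays.
have inv_k := invariants_constants act_C.
apply: (@noether_rational fs) => [|z].
  by apply: tower_sub tfs => z; rewrite inv_k.
rewrite -(eq_adjoin inv_k (frefl _ : fs =i fs)) -fsE.
by split=> [/invariantsP[]//|zf]; apply/invariantsP.
Qed.

(** Supplies the data of [monomial_invariants]: eigenvectors of the subgroup H inside the span of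
    its own variables, p-th roots of the eigenvalues of alpha^p, and generation of F by the
    translates of the eigenvectors. *)
Lemma noether_rational_index_p p e (H : {group gT}) alpha (z : K) :
  prime p -> (p.-group [set: gT])%g -> abelian H -> #|[set: gT] : H|%g = p ->
  exponent [set: gT] = (p ^ e)%N -> alpha \notin H ->
  (p ^ e)%N.-primitive_root z -> rational_over (@noether_fieldC K gT).
Proof.
move=> p_pr pG abH indexH expG alphaH z_prim.
have maxH : maximal H [set: gT] by apply: p_index_maximal; rewrite ?subsetT ?indexH.
have nHG := p_maximal_normal pG maxH.
have nH g : g \in 'N(H)%g by rewrite (subsetP (normal_norm nHG)) ?inE.
have act_C g c : noether_aut g (iota c) = iota c by apply: noether_act_C.
have act_k g c : c \in constants iota -> noether_aut g c = c.
  by move=> /asboolP[{}c ->]; apply: act_C.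
have act_x g h : noether_aut g (x h) = x (g * h)%g by apply: noether_act_var.
have expp (g : gT) : (g ^+ (p ^ e))%g = 1%g by rewrite -expG expg_exponent ?inE.
have [e' def_e] : exists e', e = e'.+1.
  case: e expp {expG z_prim} => [|e'] expp; last by exists e'.
  by rewrite -[alpha]expg1 (expp alpha) group1 in alphaH.
have alpha_pH : (alpha ^+ p)%g \in H.
  rewrite coset_idr // morphX // -indexH -card_quotient ?normal_norm //.
  by apply: expg_cardG; apply: mem_quotient; rewrite inE.
have alphaP g : exists j h, h \in H /\ g = (alpha ^+ j * h)%g.
  have /maxgroupP[_ maxHg] := maxH.
  have: g \in (<[alpha]> <*> H)%g.
    apply: contraR alphaH => ngH.
    rewrite -(maxHg [group of (<[alpha]> <*> H)%g]) ?joing_subr //.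
      by rewrite (subsetP (joing_subl _ _)) ?cycle_id.
    by rewrite properE subsetT; apply/subsetPn; exists g; rewrite ?inE.
  rewrite norm_joinEl ?cycle_subG // => /mulsgP[a h /cycleP[j ->] hH ->].
  by exists j, h.
have alphaP_small g : exists (j : 'I_p) h, h \in H /\ g = (alpha ^+ j * h)%g.
  have [j [h [hH ->]]] := alphaP g.
  exists (Ordinal (ltn_pmod j (prime_gt0 p_pr))), ((alpha ^+ p) ^+ (j %/ p) * h)%g.
  split; first by apply: groupM hH; apply: groupX.
  by rewrite mulgA -expgM -expgD /= addnC mulnC -divn_eq.
have cardHp : (#|subg_of H| * p)%N = N.
  by rewrite -[RHS]cardsT -(Lagrange (subsetT H)) indexH card_sub.
have [g h|g|u [u_eig u_gen]] := @abelian_eigenbasis K F iota (subg_of H)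
   (fun h => noether_aut (sgval h)) (fun h => x (sgval h))
   (fun h => act_C (sgval h)) (fun g h => act_x (sgval g) (sgval h))
   _ _ z z_prim _.
- by apply: val_inj; apply: (centsP abH); apply: subgP.
- apply: val_inj; rewrite /= -[RHS](expp (sgval g)).
  by elim: (p ^ e)%N => // m IHm; rewrite !expgS /= IHm.
have u_eigen i h : h \in H ->
    exists2 a, a \in constants iota & noether_aut h (u i) = a * u i.
  move=> hH; have [c hc] := u_eig i (subg H h).
  by exists (iota c); [apply: mem_constants | rewrite -hc /= subgK].
have /choice[c c_p] i : exists c, noether_aut (alpha ^+ p)%g (u i) = (iota c) ^+ p * u i.
  have [-> |u0] := eqVneq (u i) 0; first by exists 0; rewrite rmorph0 mulr0.
  have [lam lamE] : exists lam, noether_aut (alpha ^+ p)%g (u i) = iota lam * u i.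
    by have [lam lamE] := u_eig i (subg H (alpha ^+ p)%g);
      exists lam; rewrite -lamE subgK.
  have powl l : noether_aut ((alpha ^+ p) ^+ l)%g (u i) = iota (lam ^+ l) * u i.
    elim: l => [|l IHl]; first by rewrite !expg0 noether_aut1 expr0 rmorph1 mul1r.
    by rewrite expgS noether_autM IHl rmorphM act_C lamE mulrA -rmorphM -exprSr.
  (* Here the exponent p^e matters: alpha^p has order dividing p^(e-1), so its eigenvalue is an even
     power z^m with p dividing m, hence a p-th power in K. *)
  have lam1 : lam ^+ (p ^ e') = 1.
    apply: (fmorph_inj iota); apply: (mulIf u0).
    by rewrite -powl -expgM -expnS -def_e expp noether_aut1 rmorph1 mul1r.
  have lam1' : lam ^+ (p ^ e) = 1 by rewrite def_e expnS mulnC exprM lam1 expr1n.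
  have [m def_lam] : exists m, lam = z ^+ m.
    by have [m ->] := prim_rootP z_prim lam1'; exists m.
  have /dvdnP[m' def_m] : (p %| m)%N.
    move/eqP: lam1; rewrite def_lam -exprM -(prim_order_dvd z_prim) def_e expnS.
    by rewrite dvdn_pmul2r // expn_gt0 prime_gt0.
  by exists (z ^+ m'); rewrite lamE def_lam def_m -rmorphXn /= -exprM.
have zeta_prim : p.-primitive_root (iota (z ^+ (p ^ e %/ p))).
  rewrite fmorph_primitive_root; apply: dvdn_prim_root => //.
  by rewrite def_e expnS dvdn_mulr.
have [|y|fs tfs fsE] := monomial_invariants noether_aut1 noether_autM
  act_k p_pr pG nHG alphaP u_eigen (fun i => mem_constants iota (c i)) c_p
  (mem_constants iota _) zeta_prim noether_var_tower _ _.
- by rewrite size_codom card_ord cardHp.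
(* Each variable is x(alpha^j h) = alpha^j x(h) with j < p, and x(h) lies in the field of the
   u_i. *)
- apply: adjoin_min (noether_var_generate y); first exact: sub_adjoin.
  move=> _ /codomP[g ->]; have [j [h [hH ->]]] := alphaP_small g.
  rewrite -act_x; have := u_gen (subg H h); rewrite subgK //.
  apply: act_adjoin => [d dk|_ /codomP[i ->]]; first by rewrite act_k // sub_adjoin.
  by apply: mem_adjoin; apply/codomP; exists (i, j).
exact: (@noether_rational fs).
Qed.

End NoetherAction.

Theorem theorem1p8 (p n e : nat) (gT : finGroupType) (H : {group gT})
    (alpha : gT) (K : fieldType) :
  prime p ->
  (2 <= n)%N ->
  #|[set: gT]| = (p ^ n)%N ->
  abelian H ->
  #|H| = (p ^ n.-1)%N ->
  exponent [set: gT] = (p ^ e)%N ->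
  alpha \notin H ->
  (alpha ^+ p)%g \in H ->
  (forall h : gT, h \in nonpower_torsion p H ->
     [~ h, alpha]%g \in nonpower_torsion p H :|: [set 1%g]) ->
  'L_p.+1([set: gT])%g = [set 1%g] ->
  p \in [pchar K] \/
    (p \notin [pchar K] /\ exists z : K, (p ^ e)%N.-primitive_root z) ->
  rational_over (@noether_fieldC K gT).
Proof.
move=> p_pr n2 cardG abH cardH expG alphaH _ _ _ K_char.
have pG : (p.-group [set: gT])%g by rewrite /pgroup cardG pnatX pnat_id.
case: K_char => [chp|[_ [z z_prim]]]; first exact: noether_rational_pchar chp pG.
have indexH : #|[set: gT] : H|%g = p.
  rewrite -divgS ?subsetT // cardG cardH -(prednK (ltnW n2)) expnS.
  by rewrite mulnK // expn_gt0 prime_gt0.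
exact: noether_rational_index_p p_pr pG abH indexH expG alphaH z_prim.
Qed.
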